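(* Consider the finite-horizon MDP with the $\phi$-divergence distributionally robust risk $\mathcal R^\pi$, where $\phi$ has superlinear growth, and the empirical risks described in the context. There is a universal constant $C>0$ such that the following holds for any $\epsilon>0$ and $\delta\in(0,1)$, where inside the logarithms each of the quantities $L_\pi$, $\tau$, $1/\epsilon$ is read as the maximum of itself and $2$. (i) Let $\pi$ be a randomized Markovian policy of the augmented MDP with $\|\pi_t(\cdot|s,x)-\pi_t(\cdot|s,x')\|_1\le L_\pi|x-x'|$ for all $0\le t\le T$, $s\in\mathcal S_t$, $x,x'\in\mathcal X_t$, for some $L_\pi>0$. If $$n=\left\lceil C\,\frac{T^2\,g_\phi^{-1}(16T\tau/\epsilon)^2}{\epsilon^2}\log\left(\frac{T|\mathcal S|L_\pi\,\tau\,g_\phi^{-1}(16T\tau/\epsilon)}{\delta\epsilon}\right)\right\rceil,$$ then with probability at least $1-\delta$, $|\hat{\mathcal R}^\pi_n(s)-\mathcal R^\pi(s)|\le\epsilon$ for all $s\in\mathcal S_0$. (ii) If $$n=\left\lceil C\,\frac{T^3\,g_\phi^{-1}(16T\tau/\epsilon)^2}{\epsilon^2}\log\left(\frac{T|\mathcal S||\mathcal A|\,\tau\,g_\phi^{-1}(16T\tau/\epsilon)}{\delta\epsilon}\right)\right\rceil,$$ then with probability at least $1-\delta$, $|\hat{\mathcal R}^*_n(s)-\mathcal R^*(s)|\le\epsilon$ for all $s\in\mathcal S_0$.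
   Context: MDP: $T$ is a positive integer; for $0\le t\le T$, $\mathcal S_t$ is a finite state space, $\mathcal A_t$ a finite action space, $c_t:\mathcal S_t\times\mathcal A_t\to[0,1]$ a cost; for $0\le t\le T-1$, $\mathbb P_t(\cdot|s,a)$ is a probability distribution on $\mathcal S_{t+1}$. $|\mathcal S|=\max_t|\mathcal S_t|$, $|\mathcal A|=\max_t|\mathcal A_t|$. $\Pi(\mathcal M)$ is the set of randomized history-dependent policies (mapping $H_t=(S_0,A_0,\dots,S_t)$ to distributions on $\mathcal A_t$). Augmented state: $\mathcal X_t=[0,t]$, $X_0=0$, $X_{t+1}=X_t+c_t(S_t,A_t)$; a randomized Markovian policy of the augmented MDP takes $A_t\sim\pi_t(\cdot|S_t,X_t)$. Divergence function: $\phi:\mathbb R\to\mathbb R_+\cup\{+\infty\}$ is convex and lower semicontinuous, $\phi(1)=0$, $\phi(x)=+\infty$ for $x<0$, and $\lim_{x\to\infty}\phi(x)/x=\infty$. Its growth function is $g_\phi(x)=\inf_{x'\ge x}\phi(x')/x'$ for $x\ge1$, with inverse $g_\phi^{-1}(y)=\inf\{x:\ x\ge1,\ g_\phi(x)\ge y\}$. $\tau>0$ is the ambiguity radius. Risk: with $Z=\sum_{t=0}^Tc_t(S_t,A_t)$, $$\mathcal R^\pi(s)=\min_{\lambda\ge0,\ \mu\in\mathbb R}\Big\{\lambda\tau+\mu+\mathbb E^\pi_{\mathbb P}\big[(\lambda\phi)^*(Z-\mu)\mid S_0=s\big]\Big\},$$ where $(\lambda\phi)^*(y)=\sup_x\{xy-\lambda\phi(x)\}$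 is the convex conjugate of $\lambda\phi$ (with $0\cdot(+\infty)=+\infty$). This is the dual form of the worst-case expectation of $Z$ over densities $\zeta$ with $\int\phi(\zeta)\,dP\le\tau$. $\mathcal R^*(s)=\min_{\pi\in\Pi(\mathcal M)}\mathcal R^\pi(s)$. Sampling: for every $t$ and $(s,a)$ one draws $n$ i.i.d. samples from $\mathbb P_t(\cdot|s,a)$ (independently over $(t,s,a)$), giving empirical kernels $\hat{\mathbb P}_{t,n}$. $\hat{\mathcal R}^\pi_n$ is $\mathcal R^\pi$ with $\mathbb P_t$ replaced by $\hat{\mathbb P}_{t,n}$; $\hat{\mathcal R}^*_n(s)=\min_{\pi\in\Pi(\mathcal M)}\hat{\mathcal R}^\pi_n(s)$. In (i), $\pi$ does not depend on the samples. *)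

(* Defs.v *)
From HB Require Import structures.
From mathcomp Require Import all_boot all_order all_algebra.
From mathcomp Require Import all_classical all_reals all_analysis.
Set Implicit Arguments.
Unset Strict Implicit.
Unset Printing Implicit Defensive.
Import Order.TTheory GRing.Theory Num.Theory.
Import numFieldNormedType.Exports.
Local Open Scope classical_set_scope.
Local Open Scope ring_scope.

(* The products [t%:E * phi x] use the convention 0 * +oo = 0, which is
   harmless for convexity: the endpoints t = 0, 1 then give phi y <= phi y. *)
Definition is_divergence (R : realType) (phi : R -> \bar R) : Prop :=
  [/\ forall x, (0 <= phi x)%E,
      forall (x y t : R), 0 <= t <= 1 ->
        (phi (t * x + (1 - t) * y)%R
           <= t%:E * phi x + (1 - t)%:E * phi y)%E &
      lower_semicontinuous phi] /\
  [/\ phi 1 = 0%E,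
      forall x, x < 0 -> phi x = +oo%E &
      (phi x * (x^-1)%:E)%E @[x --> +oo] --> +oo%E].

Definition growth (R : realType) (phi : R -> \bar R) (x : R) : \bar R :=
  ereal_inf [set (phi x' * (x'^-1)%:E)%E | x' in [set x' : R | x <= x']].

(* The infimum is over a set bounded below by 1, and nonempty when phi has
   superlinear growth, so the real-valued [inf] is the true infimum. *)
Definition growth_inv (R : realType) (phi : R -> \bar R) (y : R) : R :=
  inf [set x : R | 1 <= x /\ (y%:E <= growth phi x)%E].

(* lam * phi with the convention 0 * (+oo) = +oo; the library product on
   extended reals has 0 * +oo = 0 instead. *)
Definition scale_divergence (R : realType) (lam : R) (phi : R -> \bar R)
    (x : R) : \bar R :=
  if phi x == +oo%E then +oo%E else (lam%:E * phi x)%E.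

Definition conjugate (R : realType) (f : R -> \bar R) (y : R) : \bar R :=
  ereal_sup [set ((x * y)%:E - f x)%E | x in [set: R]].

Definition is_distr (R : realType) (X : finType) (p : X -> R) : Prop :=
  (forall x, 0 <= p x) /\ \sum_x p x = 1.

(* All families are indexed by every natural number to keep the types simple;
   only the data at times 0 <= t <= T (0 <= t < T for the kernel) is ever
   constrained or used, the rest is irrelevant. *)
Definition transition (R : realType) (state action : nat -> finType) : Type :=
  forall t, state t -> action t -> state t.+1 -> R.

Record mdp (R : realType) := Mdp {
  horizon : nat;
  state : nat -> finType;
  action : nat -> finType;
  cost : forall t, state t -> action t -> R;
  mdp_kernel : transition R state action;
  horizon_gt0 : (0 < horizon)%N;
  action_gt0 : forall t, (t <= horizon)%N -> (0 < #|action t|)%N;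
  cost_itv : forall t, (t <= horizon)%N ->
    forall (s : state t) (a : action t), 0 <= cost s a <= 1;
  kernel_distr : forall t, (t < horizon)%N ->
    forall (s : state t) (a : action t), is_distr (mdp_kernel s a) }.

Arguments cost {R} M {t} s a : rename.
Arguments mdp_kernel {R} M t s a s' : rename.

Definition num_states (R : realType) (M : mdp R) : nat :=
  \max_(t < (horizon M).+1) #|state M t|.

Definition num_actions (R : realType) (M : mdp R) : nat :=
  \max_(t < (horizon M).+1) #|action M t|.

(* Histories (S_0, A_0, S_1, ..., A_{t-1}, S_t), as left-nested pairs. *)
Fixpoint history (R : realType) (M : mdp R) (t : nat) : finType :=
  if t is u.+1 then (history M u * action M u * state M u.+1)%type
  else state M 0.

Definition current_state (R : realType) (M : mdp R) (t : nat) :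
    history M t -> state M t :=
  match t return history M t -> state M t with
  | 0 => fun h => h
  | u.+1 => fun h => h.2
  end.

(* The augmented coordinate X_t : the cost accumulated before time t. *)
Fixpoint acc_cost (R : realType) (M : mdp R) (t : nat) : history M t -> R :=
  match t return history M t -> R with
  | 0 => fun=> 0
  | u.+1 => fun h => acc_cost h.1.1 + cost M (current_state h.1.1) h.1.2
  end.

Definition policy (R : realType) (M : mdp R) : Type :=
  forall t, history M t -> action M t -> R.

Definition is_policy (R : realType) (M : mdp R) (pi : policy M) : Prop :=
  forall t, (t <= horizon M)%N -> forall h : history M t, is_distr (pi t h).

Definition markov_policy (R : realType) (M : mdp R) : Type :=
  forall t, state M t -> R -> action M t -> R.

Definition is_markov_policy (R : realType) (M : mdp R)
    (pi : markov_policy M) : Prop :=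
  forall t, (t <= horizon M)%N -> forall (s : state M t) (x : R),
    0 <= x <= t%:R -> is_distr (pi t s x).

Definition lipschitz_policy (R : realType) (M : mdp R) (L : R)
    (pi : markov_policy M) : Prop :=
  forall t, (t <= horizon M)%N -> forall (s : state M t) (x x' : R),
    0 <= x <= t%:R -> 0 <= x' <= t%:R ->
    \sum_(a : action M t) `|pi t s x a - pi t s x' a| <= L * `|x - x'|.

Definition policy_of_markov (R : realType) (M : mdp R)
    (pi : markov_policy M) : policy M :=
  fun t h a => pi t (current_state h) (acc_cost h) a.

(* From here on the transition kernel P is an argument, so that the same risk
   can be evaluated at the true and at the empirical kernels of M. *)

Fixpoint history_prob (R : realType) (M : mdp R)
    (P : transition R (state M) (action M)) (pi : policy M) (s0 : state M 0)
    (t : nat) : history M t -> R :=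
  match t return history M t -> R with
  | 0 => fun h => (h == s0)%:R
  | u.+1 => fun h => history_prob P pi s0 h.1.1 * pi u h.1.1 h.1.2 *
                     P u (current_state h.1.1) h.1.2 h.2
  end.

(* E[f(Z) | S_0 = s0], Z being the total cost. A trajectory is a history up to
   the horizon together with the last action. Trajectories of probability 0 do
   not contribute even where f(Z) = +oo, since 0 * +oo = 0 in the library. *)
Definition cost_expectation (R : realType) (M : mdp R)
    (P : transition R (state M) (action M)) (pi : policy M) (s0 : state M 0)
    (f : R -> \bar R) : \bar R :=
  (\sum_(h : history M (horizon M)) \sum_(a : action M (horizon M))
     (history_prob P pi s0 h * pi (horizon M) h a)%:E *
     f (acc_cost h + cost M (current_state h) a)%R)%E.

Definition risk (R : realType) (M : mdp R)
    (P : transition R (state M) (action M)) (phi : R -> \bar R) (tau : R)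
    (pi : policy M) (s : state M 0) : \bar R :=
  ereal_inf [set v | exists lam mu : R, 0 <= lam /\
    v = ((lam * tau + mu)%:E +
         cost_expectation P pi s
           (fun z => conjugate (scale_divergence lam phi) (z - mu)%R))%E].

Definition optimal_risk (R : realType) (M : mdp R)
    (P : transition R (state M) (action M)) (phi : R -> \bar R) (tau : R)
    (s : state M 0) : \bar R :=
  ereal_inf [set risk P phi tau pi s | pi in [set pi | is_policy pi]].

(* xi t s a i w : the i-th sample, at outcome w, of the transition out of (s, a)
   at time t. *)
Definition sampling (R : realType) (M : mdp R) (n : nat) (Omega : Type) : Type :=
  forall t, state M t -> action M t -> 'I_n -> Omega -> state M t.+1.

(* Each sample is a random variable with law [mdp_kernel M t s a], and the finite
   family of all samples is mutually independent: the product rule is required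
   for all events {xi in B}, and taking some of the B to be the full set yields
   it for every subfamily. *)
Definition iid_samples (R : realType) (M : mdp R) (n : nat)
    (d : measure_display) (Omega : measurableType d) (Pr : probability Omega R)
    (xi : sampling M n Omega) : Prop :=
  [/\ forall t, (t < horizon M)%N ->
        forall s a (i : 'I_n) (B : {set state M t.+1}),
          measurable [set w | xi t s a i w \in B],
      forall t, (t < horizon M)%N ->
        forall s a (i : 'I_n) (s' : state M t.+1),
          Pr [set w | xi t s a i w = s'] = (mdp_kernel M t s a s')%:E &
      forall B : (forall t, state M t -> action M t -> 'I_n ->
                    {set state M t.+1}),
        Pr [set w | forall t, (t < horizon M)%N ->
                      forall s a i, xi t s a i w \in B t s a i] =
        (\prod_(t < horizon M) \prod_(s : state M t) \prod_(a : action M t)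
           \prod_(i < n) Pr [set w | xi t s a i w \in B t s a i])%E].

Definition empirical_kernel (R : realType) (M : mdp R) (n : nat) (Omega : Type)
    (xi : sampling M n Omega) (w : Omega) :
    transition R (state M) (action M) :=
  fun t s a s' => (\sum_(i < n) (xi t s a i w == s')%:R) / n%:R.

(* Main.v *)
Require Import Defs.
From HB Require Import structures.
From mathcomp Require Import all_boot all_order all_algebra.
From mathcomp Require Import all_classical all_reals all_analysis.
From mathcomp Require Import ring lra.
Set Implicit Arguments.
Unset Strict Implicit.
Unset Printing Implicit Defensive.
Import Order.TTheory GRing.Theory Num.Theory.
Import numFieldNormedType.Exports.
Local Open Scope classical_set_scope.
Local Open Scope ring_scope.

(** Adding [eps / (8 tau)] to the multiplier [lam] costs at most [eps / 8], and
    beyond that level the supremum defining the conjugate ignores every density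
    value above [G = g_phi^{-1}(16 T tau / eps)].  Moreover the objective grows
    by at most [tau] per unit of [lam] and by at most 1 per unit of [mu].  Hence
    the infimum over [(lam, mu)] is attained up to [eps / 4] on a grid of
    O((T / eps)^2) points, at each of which the integrand is nondecreasing and
    [G]-Lipschitz in the total cost, so of range O(G T).

    For a fixed policy, even a history-dependent one, the moment generating
    function of [n] times the empirical value is at most the [n]-th power of the
    one of a single trajectory, so the empirical value concentrates as a mean of
    [n] independent trajectories; this gives the factor T^2 with no union bound
    over states or costs.

    For the optimal value, one direction follows by fixing a near-optimal policy.
    For the other, let M_t be the value function maximizing
    [E exp (- theta F(Z))].  By Markov's inequality, with high probability the
    empirical mean of [ln M_{t+1}] at every state, action and cost on a grid
    exceeds [ln E M_{t+1}] by at most O(log / n); by induction on the time to go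
    [- ln M_0 / theta] is, up to [eps], below the empirical value of every policy,
    and Hoeffding's lemma compares it with the true value of a greedy policy. *)

(** * Convexity inequalities and products of finite laws *)

(** From [expR (- x) >= 1 - x] one gets [(1 - x) * expR x <= 1], while [(1 - x)(1 + x + 2 x^2) = 1 +
    x^2 (1 - 2 x)] is at least 1 for [x <= 1/2]. *)
Lemma expR_le_quad (R : realType) (x : R) :
  `|x| <= 2^-1 -> expR x <= 1 + x + 2 * x ^+ 2.
Proof.
rewrite ler_norml => /andP[x_ge x_le].
have y_gt0 : 0 < 1 - x by lra.
have: expR (- x) >= 1 - x by apply: expR_ge1Dx.
rewrite expRN => h.
have e_gt0 := expR_gt0 x.
have: (1 - x) * expR x <= 1.
  by rewrite -ler_pdivlMr// div1r.
move=> h1.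
rewrite -(ler_pM2l y_gt0); apply: (le_trans h1).
have := sqr_ge0 x; nra.
Qed.

Lemma distr_sum_gt0 (R : realType) (I : finType) (p b : I -> R) :
  is_distr p -> (forall i, 0 < b i) -> 0 < \sum_i p i * b i.
Proof.
move=> [p_ge0 p_sum] b_gt0.
rewrite lt_neqAle eq_sym; apply/andP; split; last first.
  by apply: sumr_ge0 => i _; rewrite mulr_ge0// ltW.
apply/negP; rewrite psumr_eq0; last by move=> i _; rewrite mulr_ge0// ltW.
move=> /allP h; have: \sum_i p i = 0.
  apply: big1 => i _; apply/eqP.
  by have := h i (mem_index_enum i); rewrite mulf_eq0 (gt_eqF (b_gt0 i)) orbF.
by rewrite p_sum => /eqP; rewrite oner_eq0.
Qed.

Lemma distr_sum_const (R : realType) (I : finType) (p : I -> R) (c : R) :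
  is_distr p -> \sum_i p i * c = c.
Proof. by case=> _ p_sum; rewrite -mulr_suml p_sum mul1r. Qed.

(** The tangent of [expR] at the mean [m] lies below the graph, and its average is [expR m]. *)
Lemma jensen_expR (R : realType) (I : finType) (p x : I -> R) :
  is_distr p -> expR (\sum_i p i * x i) <= \sum_i p i * expR (x i).
Proof.
move=> pd; have [p_ge0 p_sum] := pd.
set m := \sum_i p i * x i.
have -> : expR m = \sum_i p i * (expR m * (1 + (x i - m))).
  under eq_bigr => i _ do rewrite mulrCA mulrDr mulrBr.
  by rewrite -mulr_sumr !big_split/= sumrN !distr_sum_const// -/m subrr addr0 mulr1.
apply: ler_sum => i _; apply: ler_wpM2l => //.
rewrite -[in leRHS](subrK m (x i)) expRD mulrC.
by rewrite ler_pM2r ?expR_gt0// expR_ge1Dx.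
Qed.

(** The left side is the tangent of the power [n.+1] at [m]. In the induction the gap between the
    two bounds is [m^n (n + 1) (x - m)^2]. *)
Lemma pow_tangent (R : realFieldType) (n : nat) (x m : R) : 0 <= x -> 0 <= m ->
  m ^+ n * (n.+1%:R * x - n%:R * m) <= x ^+ n.+1.
Proof.
move=> x_ge0 m_ge0; elim: n => [|n ih]; first by rewrite expr0 expr1; lra.
rewrite [leRHS]exprS; apply: le_trans (ler_wpM2l x_ge0 ih).
have mn : 0 <= m ^+ n by rewrite exprn_ge0.
rewrite -subr_ge0 exprS -!natr1.
have -> : x * (m ^+ n * ((n%:R + 1) * x - n%:R * m)) -
    m * m ^+ n * ((n%:R + 1 + 1) * x - (n%:R + 1) * m) =
    m ^+ n * ((n%:R + 1) * (x - m) ^+ 2) by ring.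
by rewrite mulr_ge0// mulr_ge0// ?sqr_ge0// natr1.
Qed.

Lemma jensen_pow (R : realType) (I : finType) (n : nat) (p x : I -> R) :
  is_distr p -> (forall i, 0 <= x i) ->
  (\sum_i p i * x i) ^+ n <= \sum_i p i * x i ^+ n.
Proof.
move=> pd x_ge0; have [p_ge0 p_sum] := pd.
case: n => [|n].
  by under [leRHS]eq_bigr do rewrite expr0; rewrite distr_sum_const.
set m := \sum_i p i * x i.
have m_ge0 : 0 <= m by apply: sumr_ge0 => i _; rewrite mulr_ge0.
have -> : m ^+ n.+1 = \sum_i p i * (m ^+ n * (n.+1%:R * x i - n%:R * m)).
  under eq_bigr => i _ do rewrite mulrCA mulrBr mulrCA.
  rewrite -mulr_sumr sumrB -mulr_sumr distr_sum_const// -/m -natr1 exprS; ring.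
by apply: ler_sum => i _; apply: ler_wpM2l => //; exact: pow_tangent.
Qed.

(** Triangle inequality in L^n for the weights [w], the norms being replaced by upper bounds [b j].
    Rescaling by these bounds turns the [q]-average into [B] times an average under
    [p j = q j * b j / B], to which Jensen's inequality for powers applies. *)
Lemma minkowski_pow (R : realType) (I J : finType) (n : nat) (w : I -> R)
    (q b : J -> R) (y : I -> J -> R) :
  (forall i, 0 <= w i) -> is_distr q -> (forall j, 0 < b j) ->
  (forall i j, 0 <= y i j) ->
  (forall j, \sum_i w i * y i j ^+ n <= b j ^+ n) ->
  \sum_i w i * (\sum_j q j * y i j) ^+ n <= (\sum_j q j * b j) ^+ n.
Proof.
move=> w_ge0 qd b_gt0 y_ge0 hb; have [q_ge0 q_sum] := qd.
have B_gt0 := distr_sum_gt0 qd b_gt0; set B := \sum_j q j * b j in B_gt0 *.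
pose p j := q j * b j / B.
have pd : is_distr p.
  split; last by rewrite -mulr_suml mulfV// gt_eqF.
  by move=> j; rewrite /p mulr_ge0// ?mulr_ge0// ?invr_ge0// ltW.
have p_ge0 := pd.1.
apply: (@le_trans _ _ (\sum_i w i * (B ^+ n * \sum_j p j * (y i j / b j) ^+ n))).
  apply: ler_sum => i _; apply: ler_wpM2l => //.
  have -> : \sum_j q j * y i j = B * \sum_j p j * (y i j / b j).
    rewrite mulr_sumr; apply: eq_bigr => j _; rewrite /p.
    by field; rewrite !gt_eqF.
  rewrite exprMn ler_wpM2l ?exprn_ge0 ?(ltW B_gt0)//.
  by apply: jensen_pow => // j; rewrite divr_ge0// ltW.
under eq_bigr => i _ do rewrite mulrCA mulr_sumr.
rewrite -mulr_sumr exchange_big/= -[leRHS]mulr1 ler_wpM2l//.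
  by rewrite exprn_ge0// ltW.
rewrite -[leRHS](distr_sum_const 1 pd); apply: ler_sum => j _.
have -> : \sum_i w i * (p j * (y i j / b j) ^+ n) =
    p j * ((\sum_i w i * y i j ^+ n) / b j ^+ n).
  rewrite mulr_suml mulr_sumr; apply: eq_bigr => i _.
  by rewrite expr_div_n mulrCA -(mulrA (w i)).
by apply: ler_wpM2l => //; rewrite ler_pdivrMr ?mul1r// exprn_gt0.
Qed.

(** Coordinates are independent under a product law and [h] never selects one twice, so the
    expectation factorizes; unselected coordinates sum to 1. *)
Lemma prod_law_select (R : comNzRingType) (I J X : finType) (p : J -> X -> R)
    (h : I -> J) (f : I -> X -> R) :
  injective h -> (forall j, \sum_x p j x = 1) ->
  \sum_(om : {ffun J -> X}) (\prod_j p j (om j)) * (\prod_i f i (om (h i))) =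
  \prod_i \sum_x p (h i) x * f i x.
Proof.
move=> h_inj p_sum.
transitivity (\sum_(om : {ffun J -> X})
    \prod_j (p j (om j) * \prod_(i | h i == j) f i (om j))).
  apply: eq_bigr => om _; rewrite big_split/=; congr (_ * _).
  rewrite (partition_big h xpredT)//=; apply: eq_bigr => j _.
  by apply: eq_bigr => i /eqP->.
rewrite -(bigA_distr_bigA (fun j x => p j x * \prod_(i | h i == j) f i x)).
rewrite [RHS](partition_big h xpredT)//=; apply: eq_bigr => j _.
have [/existsP[i0 /eqP hi0]|/existsPn none] := boolP [exists i, h i == j].
  have E : (fun i => h i == j) =1 pred1 i0.
    by move=> i /=; rewrite -hi0 (inj_eq h_inj).
  rewrite (big_pred1 i0)// hi0; apply: eq_bigr => x _.
  by rewrite (big_pred1 i0).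
have E : (fun i => h i == j) =1 pred0 by move=> i; apply/negbTE/none.
rewrite [RHS]big_pred0// (eq_bigr (p j)) ?p_sum// => x _.
by rewrite (eq_bigl _ _ E) big_pred0_eq mulr1.
Qed.

(** * Backward evaluation of policies *)

Definition is_kernel (R : realType) (M : mdp R)
    (P : transition R (state M) (action M)) : Prop :=
  forall t, (t < horizon M)%N -> forall s a, is_distr (P t s a).

(* The conditional expectation of [f(Z)] given the history [h] at time [t], when
   [k = T - t]. *)
Fixpoint value (R : realType) (M : mdp R)
    (P : transition R (state M) (action M)) (pi : policy M) (f : R -> R)
    (k t : nat) : history M t -> R :=
  match k with
  | 0 => fun h =>
      \sum_a pi t h a * f (acc_cost h + cost M (current_state h) a)
  | k'.+1 => fun h => \sum_a pi t h a *
      \sum_s' P t (current_state h) a s' *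
              value P pi f k' (t := t.+1) ((h, a), s')
  end.

Lemma acc_cost_itv (R : realType) (M : mdp R) (t : nat) (h : history M t) :
  (t <= (horizon M).+1)%N -> 0 <= acc_cost h <= t%:R.
Proof.
elim: t h => [|t ih] h tT /=; first by rewrite lexx.
have /andP[h0 ht] := ih h.1.1 (ltnW tT).
have /andP[c0 c1] := @cost_itv _ M t tT (current_state h.1.1) h.1.2.
by rewrite addr_ge0//= -natr1 lerD.
Qed.

Lemma total_cost_itv (R : realType) (M : mdp R) (h : history M (horizon M))
    (a : action M (horizon M)) :
  0 <= acc_cost h + cost M (current_state h) a <= (horizon M).+1%:R.
Proof.
have /andP[h0 ht] := acc_cost_itv h (leqnSn _).
have /andP[c0 c1] := @cost_itv _ M _ (leqnn _) (current_state h) a.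
by rewrite addr_ge0//= -natr1 lerD.
Qed.

Lemma value_le (R : realType) (M : mdp R)
    (P : transition R (state M) (action M)) (pi : policy M) (f g : R -> R) :
  is_kernel P -> is_policy pi ->
  (forall z, 0 <= z <= (horizon M).+1%:R -> f z <= g z) ->
  forall k t (h : history M t), (t + k)%N = horizon M ->
  value P pi f k h <= value P pi g k h.
Proof.
move=> Pd pid fg; elim=> [|k ih] t h tk /=; apply: ler_sum => a _;
    apply: ler_wpM2l.
- by apply: (pid _ _ h).1; rewrite -tk leq_addr.
- move: h a; rewrite addn0 in tk; subst t => h a.
  by apply: fg; exact: total_cost_itv.
- by apply: (pid _ _ h).1; rewrite -tk leq_addr.
- apply: ler_sum => s' _; apply: ler_wpM2l; last by apply: ih; rewrite addSnnS.
  by apply: (Pd _ _ _ _).1; rewrite -tk -addSnnS leq_addr.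
Qed.

Lemma value_affine (R : realType) (M : mdp R)
    (P : transition R (state M) (action M)) (pi : policy M) (f : R -> R)
    (c b : R) : is_kernel P -> is_policy pi ->
  forall k t (h : history M t), (t + k)%N = horizon M ->
  value P pi (fun z => c * f z + b) k h = c * value P pi f k h + b.
Proof.
move=> Pd pid; elim=> [|k ih] t h tk /=.
  have pih : is_distr (pi t h) by apply: pid; rewrite -tk leq_addr.
  rewrite -[in RHS](distr_sum_const b pih) mulr_sumr -big_split/=.
  by apply: eq_bigr => a _; ring.
have pih : is_distr (pi t h) by apply: pid; rewrite -tk leq_addr.
rewrite -[in RHS](distr_sum_const b pih) mulr_sumr -big_split/=.
apply: eq_bigr => a _; rewrite mulrCA -mulrDr; congr (_ * _).
have Pa : is_distr (P t (current_state h) a).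
  by apply: Pd; rewrite -tk -addSnnS leq_addr.
rewrite -[in RHS](distr_sum_const b Pa) mulr_sumr -big_split/=.
apply: eq_bigr => s' _; rewrite ih; last by rewrite addSnnS.
by ring.
Qed.

Lemma value_cst (R : realType) (M : mdp R)
    (P : transition R (state M) (action M)) (pi : policy M) (c : R) :
  is_kernel P -> is_policy pi ->
  forall k t (h : history M t), (t + k)%N = horizon M ->
  value P pi (fun=> c) k h = c.
Proof.
move=> Pd pid k t h tk; have := value_affine (fun=> 0) 0 c Pd pid h tk.
by under eq_fun do rewrite mul0r add0r; rewrite mul0r add0r.
Qed.

Lemma value_gt0 (R : realType) (M : mdp R)
    (P : transition R (state M) (action M)) (pi : policy M) (f : R -> R) :
  is_kernel P -> is_policy pi -> (forall z, 0 < f z) ->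
  forall k t (h : history M t), (t + k)%N = horizon M ->
  0 < value P pi f k h.
Proof.
move=> Pd pid f_gt0; elim=> [|k ih] t h tk /=; apply: distr_sum_gt0 => //.
- by apply: pid; rewrite -tk leq_addr.
- by apply: pid; rewrite -tk leq_addr.
- move=> a; apply: distr_sum_gt0; last by move=> s'; apply: ih; rewrite addSnnS.
  by apply: Pd; rewrite -tk -addSnnS leq_addr.
Qed.

(* Hoeffding's lemma with a worse constant, from [exp x <= 1 + x + 2 x^2]. *)
Lemma value_expR_le (R : realType) (M : mdp R)
    (P : transition R (state M) (action M)) (pi : policy M) (f : R -> R)
    (m r : R) :
  is_kernel P -> is_policy pi -> r <= 2^-1 ->
  (forall z, 0 <= z <= (horizon M).+1%:R -> m <= f z <= m + r) ->
  forall k t (h : history M t), (t + k)%N = horizon M ->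
  value P pi (fun z => expR (f z)) k h <=
  expR (value P pi f k h + 2 * r ^+ 2).
Proof.
move=> Pd pid r_le fm k t h tk.
set v := value P pi f k h.
have v_ge : m <= v.
  rewrite -(value_cst m Pd pid h tk); apply: value_le => // z hz; by have /andP[] := fm z hz.
have v_le : v <= m + r.
  rewrite -(value_cst (m + r) Pd pid h tk); apply: value_le => // z hz; by have /andP[] := fm z hz.
have : value P pi (fun z => expR (- v) * expR (f z) + 0) k h <=
       value P pi (fun z => 1 * f z + (1 - v + 2 * r ^+ 2)) k h.
  apply: value_le => // z hz; have /andP[fz_ge fz_le] := fm z hz.
  rewrite addr0 -expRD addrC.
  have fv : `|f z - v| <= r by rewrite ler_norml; apply/andP; split; lra.
  apply: (le_trans (expR_le_quad (le_trans fv r_le))).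
  have : (f z - v) ^+ 2 <= r ^+ 2.
    by rewrite -[leLHS]real_normK ?num_real// lerXn2r// ?nnegrE// (le_trans _ fv).
  lra.
rewrite !value_affine// -/v addr0 => h1.
rewrite -(ler_pM2l (expR_gt0 (- v))); apply: (le_trans h1).
rewrite -expRD; apply: le_trans (expR_ge1Dx _).
lra.
Qed.

(** Tower property: each step back in time moves one action and one transition from [history_prob]
    into [value]. *)
Lemma history_sum_value (R : realType) (M : mdp R)
    (P : transition R (state M) (action M)) (pi : policy M) (s : state M 0)
    (f : R -> R) (k t : nat) : (t + k)%N = horizon M ->
  \sum_(h : history M (horizon M)) history_prob P pi s h * value P pi f 0 h =
  \sum_(h : history M t) history_prob P pi s h * value P pi f k h.
Proof.
elim: k t => [|k ih] t tk; first by rewrite addn0 in tk; subst t.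
rewrite (ih t.+1); last by rewrite addSnnS.
transitivity (\sum_(h : history M t) \sum_(a : action M t)
    \sum_(s' : state M t.+1) history_prob P pi s (t := t.+1) (h, a, s') *
      value P pi f k (t := t.+1) (h, a, s')).
  rewrite pair_bigA pair_bigA/=; apply: eq_bigr; by case=> -[h a] s' _.
apply: eq_bigr => h _ /=; rewrite mulr_sumr; apply: eq_bigr => a _.
rewrite mulrA mulr_sumr; apply: eq_bigr => s' _; by rewrite !mulrA.
Qed.

Lemma cost_expectation_fin (R : realType) (M : mdp R)
    (P : transition R (state M) (action M)) (pi : policy M) (s : state M 0)
    (f : R -> R) :
  cost_expectation P pi s (fun z => (f z)%:E) =
  (value P pi f (horizon M) (t := 0) s)%:E.
Proof.
rewrite /cost_expectation.
transitivity (\sum_(h : history M (horizon M))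
    history_prob P pi s h * value P pi f 0 h)%:E.
  rewrite -sumEFin; apply: eq_bigr => h _.
  rewrite /= mulr_sumr -sumEFin; apply: eq_bigr => a _.
  by rewrite -EFinM mulrA.
rewrite (history_sum_value _ _ _ _ (add0n _)).
congr (_%:E); rewrite (bigD1 s)//= eqxx mul1r big1 ?addr0// => h /negbTE->.
by rewrite mul0r.
Qed.

Lemma history_prob_ge0 (R : realType) (M : mdp R)
    (P : transition R (state M) (action M)) (pi : policy M) (s : state M 0) :
  is_kernel P -> is_policy pi ->
  forall t (h : history M t), (t <= horizon M)%N -> 0 <= history_prob P pi s h.
Proof.
move=> Pd pid; elim=> [|t ih] h tT /=; first by rewrite ler0n.
rewrite mulr_ge0 ?(Pd _ tT _ _).1// mulr_ge0 ?ih ?(ltnW tT)//.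
by rewrite (pid _ (ltnW tT) _).1.
Qed.

Lemma cost_expectation_le (R : realType) (M : mdp R)
    (P : transition R (state M) (action M)) (pi : policy M) (s : state M 0)
    (f g : R -> \bar R) : is_kernel P -> is_policy pi ->
  (forall z, 0 <= z <= (horizon M).+1%:R -> (f z <= g z)%E) ->
  (cost_expectation P pi s f <= cost_expectation P pi s g)%E.
Proof.
move=> Pd pid fg; apply: lee_sum => h _; apply: lee_sum => a _.
apply: lee_wpmul2l; last by apply: fg; exact: total_cost_itv.
by rewrite lee_fin mulr_ge0 ?history_prob_ge0// (pid _ (leqnn _) _).1.
Qed.

Lemma history_prob_eq (R : realType) (M : mdp R)
    (P P' : transition R (state M) (action M)) (pi : policy M) (s : state M 0) :
  (forall t, (t < horizon M)%N -> forall s a s', P t s a s' = P' t s a s') ->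
  forall t (h : history M t), (t <= horizon M)%N ->
  history_prob P pi s h = history_prob P' pi s h.
Proof.
by move=> PP'; elim=> [//|t ih] h tT /=; rewrite ih ?(ltnW tT)// PP'.
Qed.

(** Kernels are unconstrained from the horizon on. This serves to show that the confidence event
    depends only on samples drawn before the horizon. *)
Lemma risk_eq (R : realType) (M : mdp R)
    (P P' : transition R (state M) (action M)) (phi : R -> \bar R) (tau : R)
    (pi : policy M) (s : state M 0) :
  (forall t, (t < horizon M)%N -> forall s a s', P t s a s' = P' t s a s') ->
  risk P phi tau pi s = risk P' phi tau pi s.
Proof.
move=> PP'; have E f : cost_expectation P pi s f = cost_expectation P' pi s f.
  apply: eq_bigr => h _; apply: eq_bigr => a _.
  by rewrite (history_prob_eq _ _ PP').
by rewrite /risk; congr ereal_inf; apply/seteqP; split=> v /= [lam [mu [l0 ->]]];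
  exists lam, mu; rewrite E.
Qed.

Lemma optimal_risk_eq (R : realType) (M : mdp R)
    (P P' : transition R (state M) (action M)) (phi : R -> \bar R) (tau : R)
    (s : state M 0) :
  (forall t, (t < horizon M)%N -> forall s a s', P t s a s' = P' t s a s') ->
  optimal_risk P phi tau s = optimal_risk P' phi tau s.
Proof.
move=> PP'; congr ereal_inf; apply/seteqP.
by split=> v [pi pid <-]; exists pi => //; rewrite (risk_eq _ _ _ _ PP').
Qed.

(** * Empirical values *)

Lemma mass_exists (R : realType) (X I : finType) (w : X -> R)
    (B : I -> pred X) : (forall x, 0 <= w x) ->
  \sum_(x | [exists i, B i x]) w x <= \sum_i \sum_(x | B i x) w x.
Proof.
move=> w_ge0; rewrite [leLHS]big_mkcond/=.
under [leRHS]eq_bigr do rewrite big_mkcond/=.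
rewrite exchange_big/=; apply: ler_sum => x _.
case: ifPn => [/existsP[i Bix]|_]; last first.
  by apply: sumr_ge0 => i _; case: ifP.
rewrite (bigD1 i)//= Bix lerDl; apply: sumr_ge0 => j _; by case: ifP.
Qed.

Lemma mass_or (R : realType) (X : finType) (w : X -> R) (B B' : pred X) :
  (forall x, 0 <= w x) ->
  \sum_(x | B x || B' x) w x <= \sum_(x | B x) w x + \sum_(x | B' x) w x.
Proof.
move=> w_ge0; rewrite [leLHS]big_mkcond [X in _ <= X + _]big_mkcond.
rewrite [X in _ <= _ + X]big_mkcond -big_split/=; apply: ler_sum => x _.
by case: (B x); case: (B' x); rewrite /= ?addr0 ?add0r ?lerDl.
Qed.

Lemma mass_markov (R : realType) (X : finType) (w Y : X -> R) (B : pred X) :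
  (forall x, 0 <= w x) -> (forall x, 0 <= Y x) ->
  (forall x, B x -> 1 <= Y x) ->
  \sum_(x | B x) w x <= \sum_x w x * Y x.
Proof.
move=> w_ge0 Y_ge0 BY; rewrite [leLHS]big_mkcond/=; apply: ler_sum => x _.
by case: ifPn => [/BY Y1|_]; [rewrite ler_peMr|rewrite mulr_ge0].
Qed.

Definition layer (R : realType) (M : mdp R) (n t : nat) : finType :=
  {ffun state M t * action M t * 'I_n -> state M t.+1}.

(* The samples drawn at times t, ..., t + k - 1, earliest layer first: the
   nesting lets [sample_value] recurse in step with [value]. *)
Fixpoint samples (R : realType) (M : mdp R) (n k t : nat) : finType :=
  if k is k'.+1 then (layer M n t * samples M n k' t.+1)%type else unit.

Definition layer_weight (R : realType) (M : mdp R) (n t : nat)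
    (om : layer M n t) : R :=
  \prod_(j : state M t * action M t * 'I_n) mdp_kernel M t j.1.1 j.1.2 (om j).

Fixpoint sample_weight (R : realType) (M : mdp R) (n k t : nat) :
    samples M n k t -> R :=
  match k return samples M n k t -> R with
  | 0 => fun=> 1
  | k'.+1 => fun sg => layer_weight sg.1 * sample_weight sg.2
  end.

(** The empirical value as a function on the finite type [samples]: the mean over the [n] draws
    stands for integration against the empirical kernel, so that its moments are finite weighted
    sums. *)
Fixpoint sample_value (R : realType) (M : mdp R) (n : nat) (pi : policy M)
    (f : R -> R) (k t : nat) : history M t -> samples M n k t -> R :=
  match k return history M t -> samples M n k t -> R with
  | 0 => fun h _ =>
      \sum_a pi t h a * f (acc_cost h + cost M (current_state h) a)
  | k'.+1 => fun h sg => \sum_a pi t h a *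
      ((\sum_(i < n) sample_value pi f (k := k') (t := t.+1)
          (h, a, sg.1 (current_state h, a, i)) sg.2) / n%:R)
  end.

Fixpoint draw (R : realType) (M : mdp R) (n : nat) (Omega : Type)
    (xi : sampling M n Omega) (w : Omega) (k t : nat) : samples M n k t :=
  match k return samples M n k t with
  | 0 => tt
  | k'.+1 => ([ffun j : state M t * action M t * 'I_n => xi t j.1.1 j.1.2 j.2 w],
              draw xi w k' t.+1)
  end.

Lemma value_empirical (R : realType) (M : mdp R) (n : nat) (Omega : Type)
    (xi : sampling M n Omega) (w : Omega) (pi : policy M) (f : R -> R)
    (k t : nat) (h : history M t) :
  value (empirical_kernel xi w) pi f k h =
  sample_value pi f h (draw xi w k t).
Proof.
elim: k t h => [//|k ih] t h /=; apply: eq_bigr => a _; congr (_ * _).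
under eq_bigr => s' _ do rewrite /empirical_kernel mulrAC mulr_suml.
rewrite -mulr_suml exchange_big/=; congr (_ / _); apply: eq_bigr => i _.
rewrite -ih ffunE/= (bigD1 (xi t (current_state h) a i w))//= eqxx mul1r.
rewrite big1 ?addr0// => s' /negbTE s'N; by rewrite eq_sym s'N mul0r.
Qed.

Lemma empirical_kernel_distr (R : realType) (M : mdp R) (n : nat)
    (Omega : Type) (xi : sampling M n Omega) (w : Omega) :
  (0 < n)%N -> is_kernel (empirical_kernel xi w).
Proof.
move=> n_gt0 t _ s a; split=> [s'|].
  by rewrite divr_ge0// sumr_ge0.
rewrite /empirical_kernel -mulr_suml exchange_big/=.
under eq_bigr => i _.
  rewrite (bigD1 (xi t s a i w))//= eqxx big1 ?addr0; last first.
    by move=> s' /negbTE s'N; rewrite eq_sym s'N.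
  over.
by rewrite sumr_const card_ord mulfV// pnatr_eq0 -lt0n.
Qed.

Lemma layer_weight_ge0 (R : realType) (M : mdp R) (n t : nat)
    (om : layer M n t) : (t < horizon M)%N -> 0 <= layer_weight om.
Proof.
by move=> tT; apply: prodr_ge0 => j _; rewrite (kernel_distr tT _ _).1.
Qed.

Lemma layer_weight_sum (R : realType) (M : mdp R) (n t : nat) :
  (t < horizon M)%N -> \sum_(om : layer M n t) layer_weight om = 1.
Proof.
move=> tT; rewrite /layer_weight.
rewrite -(bigA_distr_bigA (fun j x => mdp_kernel M t j.1.1 j.1.2 x)) big1// => j _.
by rewrite (kernel_distr tT _ _).2.
Qed.

Lemma sample_weight_ge0 (R : realType) (M : mdp R) (n k t : nat)
    (sg : samples M n k t) : (t + k <= horizon M)%N -> 0 <= sample_weight sg.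
Proof.
elim: k t sg => [//|k ih] t sg tk /=.
rewrite mulr_ge0 ?ih ?addSnnS// layer_weight_ge0//.
by rewrite (leq_trans _ tk)// -addSnnS leq_addr.
Qed.

Lemma sample_weight_sum (R : realType) (M : mdp R) (n k t : nat) :
  (t + k <= horizon M)%N -> \sum_(sg : samples M n k t) sample_weight sg = 1.
Proof.
elim: k t => [|k ih] t tk /=.
  by rewrite sumr_const card_unit.
transitivity (\sum_(om : layer M n t) \sum_(sg : samples M n k t.+1)
    layer_weight om * sample_weight sg).
  by rewrite pair_bigA.
under eq_bigr do rewrite -mulr_sumr ih ?addSnnS// mulr1.
by apply: layer_weight_sum; rewrite (leq_trans _ tk)// -addSnnS leq_addr.
Qed.

(** Jensen's inequality moves the average over actions out of each exponential. Expanding the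
    product of these averages gives a sum over action sequences [al]; along one sequence the samples
    [(s, al i, i)] are distinct, hence independent. *)
Lemma layer_mgf (R : realType) (M : mdp R) (n t : nat) (s : state M t)
    (p : action M t -> R) (V : action M t -> state M t.+1 -> R) :
  (t < horizon M)%N -> is_distr p ->
  \sum_(om : layer M n t) layer_weight om *
    expR (\sum_(i < n) \sum_a p a * V a (om (s, a, i))) <=
  (\sum_a p a * \sum_s' mdp_kernel M t s a s' * expR (V a s')) ^+ n.
Proof.
move=> tT pd.
apply: (@le_trans _ _ (\sum_(om : layer M n t) \sum_(al : {ffun 'I_n -> action M t})
    layer_weight om * \prod_i (p (al i) * expR (V (al i) (om (s, al i, i)))))).
  apply: ler_sum => om _; rewrite -mulr_sumr ler_wpM2l ?layer_weight_ge0//.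
  rewrite -(bigA_distr_bigA (fun i a => p a * expR (V a (om (s, a, i))))).
  rewrite expR_sum; apply: ler_prod => i _; rewrite expR_ge0/=.
  exact: jensen_expR.
rewrite exchange_big/=.
under eq_bigr => al _.
  rewrite (@prod_law_select _ _ _ _ (fun j => mdp_kernel M t j.1.1 j.1.2)
    (fun i => (s, al i, i)) (fun i x => p (al i) * expR (V (al i) x))); first last.
  - by move=> j; rewrite (kernel_distr tT _ _).2.
  - by move=> i j [_].
  over.
rewrite -(bigA_distr_bigA (fun i a =>
  \sum_x mdp_kernel M t s a x * (p a * expR (V a x)))).
rewrite prodr_const card_ord le_eqVlt; apply/orP; left; apply/eqP.
congr (_ ^+ _); apply: eq_bigr => a _; rewrite mulr_sumr.
by apply: eq_bigr => s' _; rewrite mulrCA.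
Qed.

(* The empirical value is an average of averages over independent samples, so
   the convexity of [exp] and Minkowski's inequality in L^n bound its moment
   generating function by that of a mean of [n] independent trajectories: this
   costs no union bound over states, actions or accumulated costs. *)
Lemma sample_value_mgf (R : realType) (M : mdp R) (n : nat) (pi : policy M)
    (f : R -> R) : (0 < n)%N -> is_policy pi ->
  forall k t (h : history M t), (t + k)%N = horizon M ->
  \sum_(sg : samples M n k t) sample_weight sg *
    expR (n%:R * sample_value pi f h sg) <=
  value (mdp_kernel M) pi (fun z => expR (f z)) k h ^+ n.
Proof.
move=> n_gt0 pid; elim=> [|k ih] t h tk.
  have pih : is_distr (pi t h) by apply: pid; rewrite -tk leq_addr.
  rewrite (eq_bigr (fun=> expR (n%:R *
    \sum_a pi t h a * f (acc_cost h + cost M (current_state h) a)))); last first.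
    by move=> sg _ /=; rewrite mul1r.
  rewrite sumr_const card_unit expRM_natl/= mulr1n.
  by rewrite lerXn2r ?nnegrE ?expR_ge0// ?jensen_expR// sumr_ge0// => a _;
    rewrite mulr_ge0 ?expR_ge0// pih.1.
have tT : (t < horizon M)%N by rewrite -tk -addSnnS leq_addr.
have pih : is_distr (pi t h) by apply: pid; exact: ltnW.
have tk' : (t.+1 + k)%N = horizon M by rewrite addSnnS.
set P := mdp_kernel M; set s := current_state h.
pose V sg a s' := sample_value pi f (k := k) (n := n) (t := t.+1) (h, a, s') sg.
(* The layer at time [t] is integrated first, the later layers [sg] being frozen. *)
apply: (@le_trans _ _ (\sum_(sg : samples M n k t.+1) sample_weight sg *
    (\sum_a pi t h a * \sum_s' P t s a s' * expR (V sg a s')) ^+ n)).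
  rewrite (_ : \sum_sg _ = \sum_(sg : samples M n k t.+1) sample_weight sg *
      \sum_(om : layer M n t) layer_weight om *
      expR (\sum_(i < n) \sum_a pi t h a * V sg a (om (s, a, i)))).
    apply: ler_sum => sg _; apply: ler_wpM2l; last exact: layer_mgf.
    by rewrite sample_weight_ge0// tk'.
  transitivity (\sum_(om : layer M n t) \sum_(sg : samples M n k t.+1)
      sample_weight (k := k.+1) (om, sg) *
      expR (n%:R * sample_value pi f (k := k.+1) h (om, sg))).
    by rewrite pair_bigA; apply: eq_bigr => -[om sg].
  rewrite exchange_big; apply: eq_bigr => sg _; rewrite mulr_sumr.
  apply: eq_bigr => om _ /=; rewrite mulrA (mulrC (layer_weight om)).
  congr (_ * expR _); rewrite [in RHS]exchange_big/= mulr_sumr.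
  apply: eq_bigr => a _; rewrite mulrCA -mulr_sumr; congr (_ * _).
  by rewrite mulrC divfK// pnatr_eq0 -lt0n.
have w_ge0 (sg : samples M n k t.+1) : 0 <= sample_weight sg.
  by rewrite sample_weight_ge0// tk'.
have Pd : is_kernel P by move=> u uT x a; exact: kernel_distr.
have v_gt0 a s' : 0 < value P pi (fun z => expR (f z)) k (t := t.+1) (h, a, s').
  by apply: value_gt0 => // z; exact: expR_gt0.
(* Minkowski's inequality is used over actions, then over next states; the induction hypothesis
   bounds each norm. *)
apply: minkowski_pow => //.
- by move=> a; apply: distr_sum_gt0 => //; exact: Pd.
- move=> sg a; apply: sumr_ge0 => s' _.
  by rewrite mulr_ge0 ?expR_ge0// (Pd _ tT _ _).1.
move=> a; apply: minkowski_pow => //; first exact: Pd.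
move=> s'; apply: le_trans (ih t.+1 (h, a, s') tk').
by apply: ler_sum => sg _; rewrite expRM_natl.
Qed.

(** * Law of the drawn samples *)

Lemma draw_eqP (R : realType) (M : mdp R) (n : nat) (Omega : Type)
    (xi : sampling M n Omega) (w w' : Omega) (k t : nat) :
  draw xi w k t = draw xi w' k t <->
  (forall u, (t <= u < t + k)%N -> forall s a i, xi u s a i w = xi u s a i w').
Proof.
elim: k t => [|k ih] t /=.
  by split=> // _ u; rewrite addn0 ltnNge andbN.
split=> [[e1 /ih e2] u|e].
  rewrite leq_eqVlt => /andP[/orP[/eqP <- _|tu ut]] s a i.
    by have := congr1 (fun om : layer M n t => om (s, a, i)) e1; rewrite !ffunE.
  by apply: e2; rewrite tu addSnnS.
congr pair; first by apply/ffunP => j; rewrite !ffunE e// leqnn -addSnnS leq_addr.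
by apply/ih => u /andP[tu ut]; apply: e; rewrite ltnW//= -addSnnS.
Qed.

Lemma sample_weight_draw (R : realType) (M : mdp R) (n : nat) (Omega : Type)
    (xi : sampling M n Omega) (w : Omega) (k t : nat) :
  sample_weight (draw xi w k t) =
  \prod_(t <= u < t + k) \prod_(s : state M u) \prod_(a : action M u)
    \prod_(i < n) mdp_kernel M u s a (xi u s a i w).
Proof.
elim: k t => [|k ih] t /=; first by rewrite big_geq// addn0.
rewrite big_ltn -addSnnS ?leq_addr// -ih; congr (_ * _).
rewrite pair_bigA pair_bigA/=; apply: eq_bigr => -[[s a] i] _ /=.
by rewrite ffunE.
Qed.

Lemma measurable_draw (R : realType) (M : mdp R) (n : nat)
    (d : measure_display) (Omega : measurableType d) (Pr : probability Omega R)
    (xi : sampling M n Omega) (sg : samples M n (horizon M) 0) :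
  iid_samples Pr xi -> measurable [set w | draw xi w (horizon M) 0 = sg].
Proof.
move=> [mxi _ _].
have H k t (sg' : samples M n k t) : (t + k)%N = horizon M ->
    measurable [set w | draw xi w k t = sg'].
  elim: k t sg' => [|k ih] t sg' tk.
    rewrite (_ : [set _ | _] = setT)//; apply/seteqP; split=> // w _ /=.
    by case: sg'.
  case: sg' => om sg'.
  rewrite (_ : [set _ | _] = (\bigcap_(j in [set: state M t * action M t * 'I_n])
      [set w | xi t j.1.1 j.1.2 j.2 w \in [set om j]%SET]) `&`
      [set w | draw xi w k t.+1 = sg']); last first.
    apply/seteqP; split=> w /=.
      by case=> <- <-; split=> // j _ /=; rewrite ffunE finset.inE.
    case=> e <-; congr pair; apply/ffunP => j; rewrite ffunE.
    by have := e j I; rewrite /= finset.inE => /eqP.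
  apply: measurableI; last by apply: ih; rewrite addSnnS.
  apply: fin_bigcap_measurable => // j _; apply: mxi.
  by rewrite -tk -addSnnS leq_addr.
exact: H.
Qed.

(** A configuration that is never drawn has an empty event. For one drawn at [w0], the product rule
    applies to the singletons of the samples at [w0], which also supplies sets at times past the
    horizon. *)
Lemma draw_law (R : realType) (M : mdp R) (n : nat)
    (d : measure_display) (Omega : measurableType d) (Pr : probability Omega R)
    (xi : sampling M n Omega) (sg : samples M n (horizon M) 0) :
  iid_samples Pr xi ->
  (Pr [set w | draw xi w (horizon M) 0 = sg] <= (sample_weight sg)%:E)%E.
Proof.
move=> xid; have [_ law indep] := xid.
have [[w0 w0sg]|none] := pselect (exists w, draw xi w (horizon M) 0 = sg); last first.
  rewrite (_ : [set _ | _] = set0) ?measure0 ?lee_fin ?sample_weight_ge0//.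
  by apply/seteqP; split=> // w /= wsg; case: none; exists w.
rewrite -w0sg (_ : [set _ | _] = [set w | forall t, (t < horizon M)%N ->
    forall s a i, xi t s a i w \in [set xi t s a i w0]%SET]).
  rewrite (indep (fun t s a i => [set xi t s a i w0]%SET)).
  rewrite sample_weight_draw add0n big_mkord -!prodEFin.
  rewrite le_eqVlt; apply/orP; left; apply/eqP; apply: eq_bigr => t _.
  rewrite -prodEFin; apply: eq_bigr => s _.
  rewrite -prodEFin; apply: eq_bigr => a _.
  rewrite -prodEFin; apply: eq_bigr => i _.
  rewrite -(law t (ltn_ord t) s a i); congr (Pr _).
  by apply/seteqP; split=> w /=; rewrite finset.inE => /eqP.
apply/seteqP; split=> w /=.
  by move=> /draw_eqP e t tT s a i; rewrite finset.inE e.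
move=> e; apply/draw_eqP => t; rewrite add0n => tT s a i.
by have := e t tT s a i; rewrite finset.inE => /eqP.
Qed.

(** By invariance the complement of [A] is a finite union of fibres of [draw]. This makes [A]
    measurable and bounds the probability of its complement by the weight of the configurations met
    there, all of which are bad. *)
Lemma probability_ge_of_samples (R : realType) (M : mdp R) (n : nat)
    (d : measure_display) (Omega : measurableType d) (Pr : probability Omega R)
    (xi : sampling M n Omega) (A : set Omega)
    (bad : pred (samples M n (horizon M) 0)) (delta : R) :
  iid_samples Pr xi ->
  (forall w w', (forall t, (t < horizon M)%N -> forall s a i,
     xi t s a i w = xi t s a i w') -> A w -> A w') ->
  (forall w, ~~ bad (draw xi w (horizon M) 0) -> A w) ->
  \sum_(sg | bad sg) sample_weight sg <= delta ->
  ((1 - delta)%:E <= Pr A)%E.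
Proof.
move=> xid Ainv Agood bad_le.
pose bad' := [pred sg | `[< exists2 w, ~ A w & draw xi w (horizon M) 0 = sg >]].
have AC : ~` A = \big[setU/set0]_(sg | bad' sg) [set w | draw xi w (horizon M) 0 = sg].
  rewrite -bigcup_pred; apply/seteqP; split=> w /=.
    move=> nA; exists (draw xi w (horizon M) 0) => //=.
    by apply/asboolP; exists w.
  move=> [sg /asboolP[w' nA' <-]] /= /draw_eqP e Aw; apply: nA'.
  by apply: Ainv Aw => t tT; apply: e; rewrite add0n.
have mAC : measurable (~` A).
  by rewrite AC; apply: bigsetU_measurable => sg _; exact: (measurable_draw _ xid).
have mA : measurable A by rewrite -(setCK A); exact: measurableC.
suff : (Pr (~` A) <= delta%:E)%E.
  rewrite probability_setC//.
  have := probability_le1 Pr mA; have := measure_ge0 Pr A.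
  case: (Pr A) => [r| |]// _ _; rewrite -EFinB !lee_fin; lra.
apply: (@le_trans _ _ (\sum_(sg | bad' sg) (sample_weight sg)%:E)%E).
  rewrite AC.
  have : measurable (\big[setU/set0]_(sg | bad' sg) [set w | draw xi w (horizon M) 0 = sg])
      /\ (Pr (\big[setU/set0]_(sg | bad' sg) [set w | draw xi w (horizon M) 0 = sg])
      <= \sum_(sg | bad' sg) (sample_weight sg)%:E)%E; last by case.
  apply: (big_ind2 (fun (B : set Omega) y => measurable B /\ (Pr B <= y)%E)).
  - by rewrite measure0.
  - move=> B1 y1 B2 y2 [m1 h1] [m2 h2]; split; first exact: measurableU.
    by apply: (le_trans (measureU2 _ m1 m2)); exact: leeD.
  - by move=> sg _; split; [exact: (measurable_draw _ xid)|exact: draw_law].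
rewrite sumEFin lee_fin; apply: le_trans bad_le.
rewrite [leLHS]big_mkcond [leRHS]big_mkcond/=; apply: ler_sum => sg _.
have w0 : 0 <= sample_weight sg by exact: sample_weight_ge0.
case: ifPn => [/asboolP[w nA wsg]|_]; last by case: ifP.
case: ifPn => // good; exfalso; apply: nA; apply: Agood; by rewrite wsg.
Qed.

(** * Conjugate and growth functions *)

Section conjugate_theory.
Variables (R : realType) (phi : R -> \bar R).
Hypothesis phid : is_divergence phi.

(** Points with [x < 0] or [phi x = +oo] contribute [-oo] to the supremum. *)
Lemma conjugate_le (lam y : R) (v : \bar R) :
  (forall x p, 0 <= x -> 0 <= p -> phi x = p%:E -> ((x * y - lam * p)%:E <= v)%E) ->
  (conjugate (scale_divergence lam phi) y <= v)%E.
Proof.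
have [[phi_ge0 _ _] [_ phi_neg _]] := phid.
move=> h; apply: ge_ereal_sup => _ [x _ <-]; rewrite /scale_divergence.
have := phi_ge0 x; have := phi_neg x.
case E : (phi x) => [p| |]// neg p0; last by rewrite addeNy leNye.
have /h /(_ _ E) -> // : 0 <= x.
  by rewrite leNgt; apply/negP => /neg.
Qed.

Lemma conjugate_ge (lam y x p : R) : phi x = p%:E ->
  ((x * y - lam * p)%:E <= conjugate (scale_divergence lam phi) y)%E.
Proof.
by move=> E; apply: ereal_sup_ubound; exists x => //; rewrite /scale_divergence E.
Qed.

(** The point [x = 1], where [phi] vanishes, contributes [y]. *)
Lemma conjugate_ge_id (lam y : R) :
  (y%:E <= conjugate (scale_divergence lam phi) y)%E.
Proof.
have [_ [phi1 _ _]] := phid.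
by have := conjugate_ge lam y phi1; rewrite mul1r mulr0 subr0.
Qed.

Lemma conjugate_mono (lam y y' : R) : y <= y' ->
  (conjugate (scale_divergence lam phi) y <=
   conjugate (scale_divergence lam phi) y')%E.
Proof.
move=> yy'; apply: conjugate_le => x p x0 p0 E.
by apply: le_trans (conjugate_ge lam y' E); rewrite lee_fin lerB// ler_wpM2l.
Qed.

Lemma conjugate_anti (lam lam' y : R) : lam <= lam' ->
  (conjugate (scale_divergence lam' phi) y <=
   conjugate (scale_divergence lam phi) y)%E.
Proof.
move=> ll'; apply: conjugate_le => x p x0 p0 E.
by apply: le_trans (conjugate_ge lam y E); rewrite lee_fin lerB// ler_wpM2r.
Qed.

Lemma conjugate_le0 (lam y : R) : 0 <= lam -> y <= 0 ->
  (conjugate (scale_divergence lam phi) y <= 0)%E.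
Proof.
by move=> l0 y0; apply: conjugate_le => x p x0 p0 _; rewrite lee_fin; nra.
Qed.

(* Only the terms with [x >= 1] matter at [y >= 0], and they have slope at
   least 1; symmetrically for [y <= 0] below. *)
Lemma conjugate_shift_ge0 (lam y d : R) : 0 <= lam -> 0 <= y -> 0 <= d ->
  (conjugate (scale_divergence lam phi) y <=
   conjugate (scale_divergence lam phi) (y + d) - d%:E)%E.
Proof.
move=> l0 y0 d0; apply: conjugate_le => x p x0 p0 E; rewrite leeBrDr//.
have [x1|x1] := leP 1 x.
  apply: le_trans (conjugate_ge lam (y + d) E); rewrite -EFinD lee_fin; nra.
apply: le_trans (conjugate_ge_id lam (y + d)); rewrite -EFinD lee_fin; nra.
Qed.

Lemma conjugate_shift_le0 (lam y d : R) : 0 <= lam -> y <= 0 -> 0 <= d ->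
  (conjugate (scale_divergence lam phi) y <=
   conjugate (scale_divergence lam phi) (y - d) + d%:E)%E.
Proof.
move=> l0 y0 d0; apply: conjugate_le => x p x0 p0 E.
have [x1|x1] := leP x 1.
  apply: le_trans (leeD2r _ (conjugate_ge lam (y - d) E)).
  by rewrite -EFinD lee_fin; nra.
apply: le_trans (leeD2r _ (conjugate_ge_id lam (y - d))).
by rewrite -EFinD lee_fin; nra.
Qed.

Lemma growth_inv_nonempty (y : R) :
  [set x : R | 1 <= x /\ (y%:E <= growth phi x)%E] !=set0.
Proof.
have [_ [_ _ /cvgeyPge/(_ y)]] := phid.
(* Superlinearity gives [phi x / x >= y] strictly beyond [a], hence the witness [a + 1]. *)
move=> [a [_ ha]]; exists (Num.max 1 (a + 1)); split; first by rewrite le_max lexx.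
apply: le_ereal_inf_tmp => _ [x /= hx <-]; apply: ha => /=.
by apply: lt_le_trans hx; rewrite lt_max ltrDl ltr01 orbT.
Qed.

Lemma growth_inv_ge1 (y : R) : 1 <= growth_inv phi y.
Proof.
by apply: lb_le_inf; [exact: growth_inv_nonempty|move=> x []].
Qed.

(** Strictness yields a member [z] of the defining set below [x], and the growth function at [z]
    bounds [phi x / x] from below. *)
Lemma growth_inv_lt (y x p : R) : growth_inv phi y < x -> phi x = p%:E ->
  x * y <= p.
Proof.
move=> yx E.
have hi : has_inf [set x : R | 1 <= x /\ (y%:E <= growth phi x)%E].
  split; first exact: growth_inv_nonempty.
  by exists 1 => z [].
have e0 : 0 < x - growth_inv phi y by rewrite subr_gt0.
have [z [z1 yz] zx] := inf_adherent e0 hi.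
rewrite -/(growth_inv phi y) addrC subrK in zx.
have x0 : 0 < x by rewrite (le_lt_trans _ zx)// (le_trans _ z1).
have : (y%:E <= phi x * (x^-1)%:E)%E.
  by apply: (le_trans yz); apply: ereal_inf_lbound; exists x => //=; exact: ltW.
by rewrite E -EFinM lee_fin ler_pdivlMr// mulrC.
Qed.

(* Terms with [x] beyond [growth_inv phi y0] are dominated by the term [x = 1]. *)
Lemma conjugate_lipschitz (lam y0 z z' : R) : 0 <= lam -> z <= z' ->
  z' <= lam * y0 ->
  (conjugate (scale_divergence lam phi) z' <=
   conjugate (scale_divergence lam phi) z +
   (growth_inv phi y0 * (z' - z))%:E)%E.
Proof.
move=> l0 zz' z'y; apply: conjugate_le => x p x0 p0 E.
set G := growth_inv phi y0; have G1 : 1 <= G := growth_inv_ge1 y0.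
have [xG|Gx] := leP x G.
  apply: le_trans (leeD2r _ (conjugate_ge lam z E)).
  by rewrite -EFinD lee_fin; nra.
apply: le_trans (leeD2r _ (conjugate_ge_id lam z)).
rewrite -EFinD lee_fin.
have xy : x * y0 <= p := growth_inv_lt Gx E.
have h : x * z' - lam * p <= x * (z' - lam * y0).
  by rewrite mulrBr lerB// mulrCA ler_wpM2l.
have [z'0|z'0] := leP 0 z'.
  apply: (le_trans h); apply: (@le_trans _ _ 0); first by nra.
  by nra.
nra.
Qed.

(** The conjugate dominates the identity. It is at most its value at [lam * y0], which the Lipschitz
    bound compares with the value at 0, itself at most 0. *)
Lemma conjugate_fin (lam y0 z : R) : 0 <= lam -> 0 <= y0 -> z <= lam * y0 ->
  conjugate (scale_divergence lam phi) z \is a fin_num.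
Proof.
move=> l0 y0_ge0 zy.
have lo := conjugate_ge_id lam z.
have hi : (conjugate (scale_divergence lam phi) z <
    +oo)%E.
  apply: (le_lt_trans (conjugate_mono lam zy)).
  have ly : 0 <= lam * y0 by rewrite mulr_ge0.
  apply: (le_lt_trans (conjugate_lipschitz l0 ly (lexx _))).
  apply: (le_lt_trans (leeD2r _ (conjugate_le0 l0 (lexx 0)))).
  by rewrite add0e ltry.
by rewrite fin_real// hi (lt_le_trans _ lo)// ltNyr.
Qed.

End conjugate_theory.

(** * Discretization of the dual problem *)

(* The integrand of the dual objective. Capping the cost at [Z], an upper bound
   of the total cost, makes it monotone and Lipschitz on the whole line. *)
Definition dual_integrand (R : realType) (phi : R -> \bar R)
    (tau Z lam mu z : R) : R :=
  lam * tau + mu +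
  fine (conjugate (scale_divergence lam phi) (Num.min z Z - mu)).

(** Indices are shifted by one: a multiplier of at least [eps / (8 * tau)] keeps the argument of the
    conjugate below [lam * y0], where it is finite and Lipschitz. One grid step costs [eps / 8] in
    [lam * tau] and [eps / 8] in [mu]. *)
Definition grid_integrand (R : realType) (phi : R -> \bar R) (tau eps Z : R)
    (j k : nat) : R -> R :=
  dual_integrand phi tau Z (j.+1%:R * (eps / (8 * tau))) (k.+1%:R * (eps / 8)).

(** The ranges [0 <= lam * tau <= Z] and [0 <= mu <= Z] are both cut into steps of [eps / 8]. *)
Definition grid_size (R : realType) (eps Z : R) : nat :=
  (Num.truncn (8 * Z / eps)).+1.

Section grid.
Variables (R : realType) (phi : R -> \bar R) (tau eps Z y0 : R).
Hypotheses (phid : is_divergence phi) (tau_gt0 : 0 < tau) (eps_gt0 : 0 < eps).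
Hypotheses (Z_ge0 : 0 <= Z) (Zy0 : Z <= eps / (8 * tau) * y0).

Let lam0 : R := eps / (8 * tau).
Let lam0_gt0 : 0 < lam0. Proof. by rewrite divr_gt0// mulr_gt0. Qed.
Let y0_ge0 : 0 <= y0.
Proof. by rewrite -(pmulr_rge0 _ lam0_gt0) (le_trans Z_ge0). Qed.

Let grid_lam_ge0 (j : nat) : 0 <= j.+1%:R * lam0.
Proof. by rewrite mulr_ge0// ltW. Qed.

Let grid_arg_le (j k : nat) (z : R) :
  Num.min z Z - k.+1%:R * (eps / 8) <= j.+1%:R * lam0 * y0.
Proof.
have h : Z <= j.+1%:R * lam0 * y0.
  rewrite (le_trans Zy0)// -[leRHS]mulrA ler_peMl ?ler1n// mulr_ge0//.
  exact: ltW.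
have h2 : 0 <= k.+1%:R * (eps / 8) by rewrite mulr_ge0// divr_ge0// ltW.
have h3 : Num.min z Z <= Z by rewrite ge_min lexx orbT.
lra.
Qed.

Lemma grid_integrand_mono (j k : nat) (z z' : R) : z <= z' ->
  grid_integrand phi tau eps Z j k z <= grid_integrand phi tau eps Z j k z'.
Proof.
move=> zz'; rewrite lerD2l fine_le//.
- exact: (conjugate_fin phid (grid_lam_ge0 j) y0_ge0 (grid_arg_le j k z)).
- exact: (conjugate_fin phid (grid_lam_ge0 j) y0_ge0 (grid_arg_le j k z')).
- by apply: conjugate_mono => //; rewrite lerD2r le_min2.
Qed.

Lemma grid_integrand_lipschitz (j k : nat) (z z' : R) : z <= z' ->
  grid_integrand phi tau eps Z j k z' <=
  grid_integrand phi tau eps Z j k z + growth_inv phi y0 * (z' - z).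
Proof.
move=> zz'; rewrite -addrA lerD2l.
have f := conjugate_fin phid (grid_lam_ge0 j) y0_ge0 (grid_arg_le j k z).
have f' := conjugate_fin phid (grid_lam_ge0 j) y0_ge0 (grid_arg_le j k z').
have mm : Num.min z Z - k.+1%:R * (eps / 8) <= Num.min z' Z - k.+1%:R * (eps / 8).
  by rewrite lerD2r le_min2.
have := conjugate_lipschitz phid (grid_lam_ge0 j) mm (grid_arg_le j k z').
rewrite -[in X in (X <= _)%E -> _](fineK f') -[in X in (_ <= X)%E -> _](fineK f).
rewrite -EFinD lee_fin => h; apply: (le_trans h).
rewrite lerD2l ler_wpM2l//; first by rewrite (le_trans _ (growth_inv_ge1 phid y0)).
rewrite opprD addrACA opprK [- _ + _]addrC subrr addr0.
by rewrite /Num.min; case: ltP => h1; case: ltP => h2; lra.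
Qed.

Lemma grid_integrandE (j k : nat) (z : R) : z <= Z ->
  (grid_integrand phi tau eps Z j k z)%:E =
  ((j.+1%:R * lam0 * tau + k.+1%:R * (eps / 8))%:E +
   conjugate (scale_divergence (j.+1%:R * lam0) phi)
     (z - k.+1%:R * (eps / 8)))%E.
Proof.
move=> zZ; rewrite EFinD fineK; first by rewrite min_l.
exact: (conjugate_fin phid (grid_lam_ge0 j) y0_ge0 (grid_arg_le j k z)).
Qed.

(* Rounding [lam] and [mu] up to the grid decreases the conjugate term, so it
   raises the objective by at most the two grid steps. *)
Let grid_round (lam mu : R) : 0 <= lam -> lam * tau <= Z -> 0 <= mu <= Z ->
  exists j k : 'I_(grid_size eps Z), forall z, z <= Z ->
  ((grid_integrand phi tau eps Z j k z)%:E <=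
   (lam * tau + mu + eps / 4)%:E +
   conjugate (scale_divergence lam phi) (z - mu))%E.
Proof.
move=> l0 lZ /andP[m0 mZ].
have jP : (Num.truncn (lam / lam0) < grid_size eps Z)%N.
  rewrite ltnS le_truncn// ler_pdivrMr// /lam0.
  rewrite (_ : 8 * Z / eps * (eps / (8 * tau)) = Z / tau).
    by rewrite ler_pdivlMr.
  by field; rewrite !gt_eqF.
have kP : (Num.truncn (mu / (eps / 8)) < grid_size eps Z)%N.
  rewrite ltnS le_truncn// invf_div mulrA ler_pM2r ?invr_gt0//; lra.
exists (Ordinal jP), (Ordinal kP) => z zZ; rewrite grid_integrandE//=.
set j := Num.truncn (lam / lam0); set k := Num.truncn (mu / (eps / 8)).
have /andP[jl lj] : (j%:R <= lam / lam0 < j.+1%:R).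
  by apply: truncn_itv; rewrite divr_ge0// ltW.
have /andP[km mk] : (k%:R <= mu / (eps / 8) < k.+1%:R).
  by apply: truncn_itv; rewrite divr_ge0// divr_ge0// ltW.
have e8 : 0 < eps / 8 by rewrite divr_gt0.
rewrite ler_pdivlMr// in jl; rewrite ltr_pdivrMr// in lj.
rewrite ler_pdivlMr// in km; rewrite ltr_pdivrMr// in mk.
have l0t : lam0 * tau = eps / 8 by rewrite /lam0; field; rewrite !gt_eqF.
apply: leeD.
  rewrite lee_fin -(natr1 j) -(natr1 k) !mulrDl !mul1r l0t.
  have : j%:R * lam0 * tau <= lam * tau by rewrite ler_pM2r.
  lra.
apply: le_trans (conjugate_anti phid _ (ltW lj)) _.
by apply: conjugate_mono => //; rewrite lerD2l lerN2 ltW.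
Qed.

(** Outside the box covered by the grid the objective is no better than at a point of the box. If
    [lam * tau > Z], the pair [(0, Z)] has value at most [Z], whereas the given pair has value at
    least [lam * tau + z]. If [mu < 0] or [mu > Z], the slope of the conjugate lets [mu] be moved to
    0 or to [Z]. *)
Lemma grid_cover (lam mu : R) : 0 <= lam ->
  exists j k : 'I_(grid_size eps Z), forall z, 0 <= z <= Z ->
  ((grid_integrand phi tau eps Z j k z)%:E <=
   (lam * tau + mu + eps / 4)%:E +
   conjugate (scale_divergence lam phi) (z - mu))%E.
Proof.
move=> l0.
have [lZ|lZ] := leP (lam * tau) Z; last first.
  have [j [k h]] := @grid_round 0 Z (lexx _) ltac:(by rewrite mul0r) ltac:(by rewrite Z_ge0 lexx).
  exists j, k => z /andP[z0 zZ]; apply: (le_trans (h z zZ)).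
  apply: (le_trans (leeD2l _ (conjugate_le0 phid (lexx 0) _))); first by rewrite subr_le0.
  apply: le_trans (leeD2l _ (conjugate_ge_id phid _ _)).
  rewrite adde0 -EFinD lee_fin; lra.
have [m0|m0] := ltP mu 0.
  have [j [k h]] := @grid_round lam 0 l0 lZ ltac:(by rewrite lexx Z_ge0).
  exists j, k => z /andP[z0 zZ]; apply: (le_trans (h z zZ)).
  rewrite subr0; have := @conjugate_shift_ge0 _ _ phid lam z (- mu) l0 z0 ltac:(lra).
  move=> h2; apply: le_trans (leeD2l _ h2) _.
  rewrite addeA addeAC -EFinN -EFinD leeD2r// lee_fin; lra.
have [mZ|mZ] := leP mu Z; last first.
  have [j [k h]] := @grid_round lam Z l0 lZ ltac:(by rewrite Z_ge0 lexx).
  exists j, k => z /andP[z0 zZ]; apply: (le_trans (h z zZ)).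
  have := @conjugate_shift_le0 _ _ phid lam (z - Z) (mu - Z) l0 ltac:(lra) ltac:(lra).
  rewrite (_ : z - Z - (mu - Z) = z - mu); last by ring.
  move=> h2; apply: le_trans (leeD2l _ h2) _.
  rewrite addeA addeAC -EFinD leeD2r// lee_fin; lra.
have [j [k h]] := @grid_round lam mu l0 lZ ltac:(by rewrite m0 mZ).
by exists j, k => z /andP[z0 zZ]; exact: h.
Qed.

End grid.

(** * The risk and its grid values *)

Section risk_bounds.
Variables (R : realType) (M : mdp R) (phi : R -> \bar R) (tau eps y0 : R).
Variables (P : transition R (state M) (action M)) (pi : policy M) (s : state M 0).
Hypotheses (phid : is_divergence phi) (tau_gt0 : 0 < tau) (eps_gt0 : 0 < eps).
Hypotheses (Pd : is_kernel P) (pid : is_policy pi).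
Let Z : R := (horizon M).+1%:R.
Hypothesis Zy0 : Z <= eps / (8 * tau) * y0.

Lemma risk_ge0 : (0 <= risk P phi tau pi s)%E.
Proof.
apply/ereal_infP => _ [lam [mu [l0 ->]]].
apply: (@le_trans _ _ ((lam * tau + mu)%:E +
    cost_expectation P pi s (fun=> (- mu)%:E))%E).
  rewrite cost_expectation_fin value_cst// -EFinD lee_fin addrK.
  by rewrite mulr_ge0// ltW.
apply: leeD2l; apply: cost_expectation_le => // z /andP[z0 _].
apply: le_trans (conjugate_ge_id phid _ _); by rewrite lee_fin; lra.
Qed.

(** At [lam = 0] and [mu = Z] the argument of the conjugate is nonpositive for every attainable
    cost. *)
Lemma risk_le_total : (risk P phi tau pi s <= Z%:E)%E.
Proof.
apply: ge_ereal_inf; exists ((0 * tau + Z)%:E + cost_expectation P pi s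
    (fun z => conjugate (scale_divergence 0 phi) (z - Z)%R))%E.
  by exists 0, Z.
apply: (@le_trans _ _ ((0 * tau + Z)%:E + cost_expectation P pi s (fun=> 0%:E))%E).
  apply: leeD2l; apply: cost_expectation_le => // z /andP[_ zZ].
  by apply: conjugate_le0 => //; rewrite subr_le0.
by rewrite cost_expectation_fin value_cst// -EFinD mul0r add0r addr0.
Qed.

Lemma risk_le_grid (j k : nat) :
  (risk P phi tau pi s <=
   (value P pi (grid_integrand phi tau eps Z j k) (horizon M) (t := 0) s)%:E)%E.
Proof.
set lam := j.+1%:R * (eps / (8 * tau)); set mu := k.+1%:R * (eps / 8).
apply: ge_ereal_inf; exists ((lam * tau + mu)%:E + cost_expectation P pi s
    (fun z => conjugate (scale_divergence lam phi) (z - mu)%R))%E.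
  exists lam, mu; split=> //.
  by rewrite mulr_ge0// divr_ge0 ?mulr_ge0// ltW.
apply: (@le_trans _ _ ((lam * tau + mu)%:E + cost_expectation P pi s
   (fun z => (1 * grid_integrand phi tau eps Z j k z - (lam * tau + mu))%:E))%E).
  apply: leeD2l; apply: cost_expectation_le => // z /andP[_ zZ].
  rewrite mul1r EFinB (grid_integrandE phid tau_gt0 eps_gt0 _ Zy0)//.
  by rewrite -/lam -/mu addeAC -EFinB subrr add0e.
by rewrite cost_expectation_fin value_affine// mul1r -EFinD addrC subrK.
Qed.

(** Every feasible pair is matched by a grid point up to [eps / 4]. With [risk_le_grid], the risk
    and the least grid value agree up to [eps / 4]. *)
Lemma risk_ge_grid (v : R) :
  (forall j k : 'I_(grid_size eps Z),
     v <= value P pi (grid_integrand phi tau eps Z j k) (horizon M) (t := 0) s) ->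
  ((v - eps / 4)%:E <= risk P phi tau pi s)%E.
Proof.
move=> vle; apply/ereal_infP => _ [lam [mu [l0 ->]]].
have [j [k h]] := grid_cover phid tau_gt0 eps_gt0 (ler0n _ _) Zy0 mu l0.
apply: (@le_trans _ _ ((lam * tau + mu)%:E + cost_expectation P pi s
   (fun z => (1 * grid_integrand phi tau eps Z j k z - (lam * tau + mu + eps / 4))%:E))%E).
  rewrite cost_expectation_fin value_affine// mul1r -EFinD lee_fin.
  by have := vle j k; lra.
apply: leeD2l; apply: cost_expectation_le => // z hz.
by rewrite mul1r EFinB leeBlDr// addeC h.
Qed.

End risk_bounds.

(** * Concentration for a fixed policy *)

Lemma sample_value_scale (R : realType) (M : mdp R) (n : nat) (pi : policy M)
    (f : R -> R) (c : R) (k t : nat) (h : history M t) (sg : samples M n k t) :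
  sample_value pi (fun z => c * f z) h sg = c * sample_value pi f h sg.
Proof.
elim: k t h sg => [|k ih] t h sg /=; rewrite mulr_sumr; apply: eq_bigr => a _.
  by rewrite mulrCA.
rewrite [RHS]mulrCA; congr (_ * _); rewrite mulrA mulr_sumr; congr (_ / _).
by apply: eq_bigr => i _; rewrite ih.
Qed.

(* Chernoff's bound with [theta = e / (4 r^2)]. *)
Lemma sample_value_upper_tail (R : realType) (M : mdp R) (n : nat)
    (pi : policy M) (f : R -> R) (m r e : R) (s : state M 0) :
  (0 < n)%N -> is_policy pi -> 0 < r -> 0 < e <= 2 * r ->
  (forall z, 0 <= z <= (horizon M).+1%:R -> m <= f z <= m + r) ->
  \sum_(sg : samples M n (horizon M) 0 |
      value (mdp_kernel M) pi f (horizon M) (t := 0) s + e <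
      sample_value pi f (t := 0) s sg) sample_weight sg <=
  expR (- (n%:R * e ^+ 2 / (8 * r ^+ 2))).
Proof.
move=> n0 pid r0 /andP[e0 er] fm.
have Pd : is_kernel (mdp_kernel M) by move=> u uT x a; exact: kernel_distr.
set V := value _ _ _ _ _; pose th := e / (4 * r ^+ 2).
have th0 : 0 < th by rewrite divr_gt0// mulr_gt0// exprn_gt0.
have n_ge0 : 0 <= n%:R :> R by [].
pose Y (sg : samples M n (horizon M) 0) :=
  expR (n%:R * sample_value pi (fun z => th * f z) (t := 0) s sg) *
  expR (- (n%:R * th * (V + e))).
apply: (@le_trans _ _ (\sum_sg sample_weight sg * Y sg)).
  apply: mass_markov => [sg|sg|sg].
  - exact: sample_weight_ge0.
  - by rewrite mulr_ge0 ?expR_ge0.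
  - move=> h; rewrite /Y sample_value_scale -expRD.
    apply: le_trans (expR_ge1Dx _); rewrite lerDl mulrA -mulrBr.
    apply: mulr_ge0; last by rewrite subr_ge0 ltW.
    by rewrite mulr_ge0// ltW.
under eq_bigr => sg _ do rewrite mulrA.
rewrite -mulr_suml.
have mgf := sample_value_mgf (fun z => th * f z) n0 pid (t := 0) s (add0n _).
apply: (le_trans (ler_wpM2r (expR_ge0 _) mgf)).
have thr : th * r = e / (4 * r) by rewrite /th; field; rewrite gt_eqF.
have bd : value (mdp_kernel M) pi (fun z => expR (th * f z)) (horizon M) (t := 0) s
    <= expR (th * V + 2 * (th * r) ^+ 2).
  have := @value_expR_le _ _ (mdp_kernel M) pi (fun z => th * f z) (th * m) (th * r)
    Pd pid _ _ (horizon M) 0 s (add0n _).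
  have -> : value (mdp_kernel M) pi (fun z => th * f z) (horizon M) (t := 0) s = th * V.
    have := value_affine f th 0 Pd pid (t := 0) s (add0n _).
    by rewrite addr0 => <-; under [in RHS]eq_fun do rewrite addr0.
  (* The hypothesis [e <= 2 * r] makes [th * r = e / (4 * r)] at most 1/2. *)
  apply; first by rewrite thr ler_pdivrMr ?mulr_gt0//; lra.
  by move=> z /fm /andP[h1 h2]; rewrite -mulrDr !ler_pM2l// h1 h2.
apply: (@le_trans _ _ (expR (th * V + 2 * (th * r) ^+ 2) ^+ n *
    expR (- (n%:R * th * (V + e))))).
  rewrite ler_wpM2r ?expR_ge0// lerXn2r ?nnegrE ?expR_ge0//.
  by apply/ltW/value_gt0 => // z; exact: expR_gt0.
rewrite -expRM_natl -expRD ler_expR le_eqVlt; apply/orP; left; apply/eqP.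
by rewrite /th; field; rewrite gt_eqF.
Qed.

Lemma sample_value_tail (R : realType) (M : mdp R) (n : nat)
    (pi : policy M) (f : R -> R) (m r e : R) (s : state M 0) :
  (0 < n)%N -> is_policy pi -> 0 < r -> 0 < e <= 2 * r ->
  (forall z, 0 <= z <= (horizon M).+1%:R -> m <= f z <= m + r) ->
  \sum_(sg : samples M n (horizon M) 0 |
      e < `|sample_value pi f (t := 0) s sg -
            value (mdp_kernel M) pi f (horizon M) (t := 0) s|) sample_weight sg <=
  2 * expR (- (n%:R * e ^+ 2 / (8 * r ^+ 2))).
Proof.
move=> n0 pid r0 er fm.
have Pd : is_kernel (mdp_kernel M) by move=> u uT x a; exact: kernel_distr.
have up := sample_value_upper_tail s n0 pid r0 er fm.
(* The lower tail of [f] is the upper tail of [- f], whose values lie in [[- m - r, - m]]. *)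
have fm' z : 0 <= z <= (horizon M).+1%:R ->
    - m - r <= -1 * f z <= - m - r + r.
  by move=> /fm /andP[h1 h2]; apply/andP; split; lra.
have lo := sample_value_upper_tail s n0 pid r0 er fm'.
have vN : value (mdp_kernel M) pi (fun z => -1 * f z) (horizon M) (t := 0) s =
    - value (mdp_kernel M) pi f (horizon M) (t := 0) s.
  have := value_affine f (-1) 0 Pd pid (t := 0) s (add0n _).
  by rewrite addr0 mulN1r => <-; under [in RHS]eq_fun do rewrite addr0.
rewrite vN in lo.
set V := value _ _ _ _ _ in up lo *.
rewrite [leRHS](_ : _ = expR (- (n%:R * e ^+ 2 / (8 * r ^+ 2))) +
  expR (- (n%:R * e ^+ 2 / (8 * r ^+ 2)))); last by ring.
apply: le_trans (lerD up lo).
rewrite [leLHS]big_mkcond [X in _ <= X + _]big_mkcond [X in _ <= _ + X]big_mkcond/=.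
rewrite -big_split/=; apply: ler_sum => sg _.
have w0 : 0 <= sample_weight sg by exact: sample_weight_ge0.
rewrite sample_value_scale.
case: ifPn => [|_]; last by rewrite addr_ge0//; case: ifP.
rewrite lter_normr => /orP[h|h].
  by rewrite ifT ?lerDl; [case: ifP|lra].
by rewrite [X in _ <= _ + X]ifT ?lerDr; [case: ifP|lra].
Qed.

(** * Exponential dynamic programming *)

(** Bellman recursion of the augmented MDP for the utility [u] of the total cost, [x] being the
    accumulated cost. The default 0 of the maximum is harmless for positive [u]. *)
Fixpoint max_value (R : realType) (M : mdp R) (u : R -> R) (k t : nat) :
    state M t -> R -> R :=
  match k with
  | 0 => fun s x => \big[Num.max/0]_(a : action M t) u (x + cost M s a)
  | k'.+1 => fun s x => \big[Num.max/0]_(a : action M t)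
      \sum_s' mdp_kernel M t s a s' *
              max_value u k' (t := t.+1) s' (x + cost M s a)
  end.

Definition action_value (R : realType) (M : mdp R) (u : R -> R) (k t : nat)
    (s : state M t) (x : R) (a : action M t) : R :=
  if k is k'.+1 then \sum_s' mdp_kernel M t s a s' *
                       max_value u k' (t := t.+1) s' (x + cost M s a)
  else u (x + cost M s a).

Lemma max_valueE (R : realType) (M : mdp R) (u : R -> R) (k t : nat)
    (s : state M t) (x : R) :
  max_value u k s x = \big[Num.max/0]_(a : action M t) action_value u k s x a.
Proof. by case: k. Qed.

Lemma action_value_le (R : realType) (M : mdp R) (u : R -> R) (k t : nat)
    (s : state M t) (x : R) (a : action M t) :
  action_value u k s x a <= max_value u k s x.
Proof. by rewrite max_valueE; exact: le_bigmax. Qed.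

Lemma action_exists (R : realType) (M : mdp R) (t : nat) :
  (t <= horizon M)%N -> exists a : action M t, true.
Proof. by move=> /(@action_gt0 _ M) /card_gt0P[a _]; exists a. Qed.

Lemma max_value_gt0 (R : realType) (M : mdp R) (u : R -> R) :
  (forall z, 0 < u z) ->
  forall k t (s : state M t) x, (t + k)%N = horizon M -> 0 < max_value u k s x.
Proof.
move=> u0; elim=> [|k ih] t s x tk.
  have [|a _] := @action_exists _ M t; first by rewrite -tk leq_addr.
  exact: lt_le_trans (u0 _) (action_value_le u 0 s x a).
have tT : (t < horizon M)%N by rewrite -tk -addSnnS leq_addr.
have [a _] := action_exists (ltnW tT).
apply: lt_le_trans (action_value_le u k.+1 s x a).
apply: distr_sum_gt0; first exact: kernel_distr.
by move=> s'; apply: ih; rewrite addSnnS.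
Qed.

(** Shifting the accumulated cost shifts every total cost alike. With [c = 1] this gives
    monotonicity in the cost; with [c = expR kap], the Lipschitz property of the logarithm. *)
Lemma max_value_shift (R : realType) (M : mdp R) (u : R -> R) (c d : R) :
  0 <= c -> (forall z, 0 < u z) -> (forall z, u z <= c * u (z + d)) ->
  forall k t (s : state M t) x, (t + k)%N = horizon M ->
  max_value u k s x <= c * max_value u k s (x + d).
Proof.
move=> c0 u0 ucd; elim=> [|k ih] t s x tk.
  rewrite [leLHS]max_valueE; apply: bigmax_le => [|a _].
    by rewrite mulr_ge0// ltW// max_value_gt0.
  apply: (le_trans (ucd _)); apply: ler_wpM2l => //.
  by have := action_value_le u 0 s (x + d) a; rewrite /= addrAC.
rewrite [leLHS]max_valueE; apply: bigmax_le => [|a _].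
  by rewrite mulr_ge0// ltW// max_value_gt0.
apply: le_trans (ler_wpM2l c0 (action_value_le u k.+1 s (x + d) a)).
rewrite /= mulr_sumr; apply: ler_sum => s' _.
have tT : (t < horizon M)%N by rewrite -tk -addSnnS leq_addr.
rewrite mulrCA ler_wpM2l ?(kernel_distr tT _ _).1//.
by rewrite [x + d + _]addrAC ih// addSnnS.
Qed.

Definition greedy (R : realType) (M : mdp R) (u : R -> R) : policy M :=
  fun t h a => (Some a == [pick b |
    action_value u (horizon M - t) (current_state h) (acc_cost h) b ==
    max_value u (horizon M - t) (current_state h) (acc_cost h)])%:R.

(** Action values are nonnegative, so the default 0 does not exceed them all and some action attains
    the maximum: the [pick] in [greedy] succeeds. *)
Lemma greedyP (R : realType) (M : mdp R) (u : R -> R) (t : nat)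
    (h : history M t) : (forall z, 0 < u z) -> (t <= horizon M)%N ->
  exists2 a, greedy u h =1 (fun b => (b == a)%:R) &
    action_value u (horizon M - t) (current_state h) (acc_cost h) a =
    max_value u (horizon M - t) (current_state h) (acc_cost h).
Proof.
move=> u0 tT; rewrite /greedy; case: pickP => [a /eqP ea|none].
  by exists a.
have [a0 _] := action_exists tT.
have av0 a : 0 <= action_value u (horizon M - t) (current_state h) (acc_cost h) a.
  have : (t + (horizon M - t))%N = horizon M by rewrite subnKC.
  case: (horizon M - t)%N => [|k] tk /=; first exact: ltW.
  have tT' : (t < horizon M)%N by rewrite -tk -addSnnS leq_addr.
  apply: sumr_ge0 => s' _; rewrite mulr_ge0 ?(kernel_distr tT' _ _).1//.
  by apply/ltW/max_value_gt0; rewrite // addSnnS.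
have [a _ ea] := @eq_bigmax _ _ _ 0 a0 xpredT
  (action_value u (horizon M - t) (current_state h) (acc_cost h)) isT
  (fun a _ => av0 a).
by have := none a; rewrite max_valueE ea eqxx.
Qed.

Lemma greedy_policy (R : realType) (M : mdp R) (u : R -> R) :
  (forall z, 0 < u z) -> is_policy (greedy (M := M) u).
Proof.
move=> u0 t tT h; have [a ga _] := greedyP h u0 tT.
split=> [b|]; first by rewrite ga.
rewrite (bigD1 a)//= ga eqxx big1 ?addr0// => b /negbTE ba.
by rewrite ga ba.
Qed.

Lemma greedy_value (R : realType) (M : mdp R) (u : R -> R) :
  (forall z, 0 < u z) ->
  forall k t (h : history M t), (t + k)%N = horizon M ->
  value (mdp_kernel M) (greedy u) u k h =
  max_value u k (current_state h) (acc_cost h).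
Proof.
move=> u0; elim=> [|k ih] t h tk.
  have tT : (t <= horizon M)%N by rewrite -tk leq_addr.
  have [a ga] := greedyP h u0 tT.
  have -> : (horizon M - t)%N = 0%N by rewrite -tk addKn.
  move=> <- /=.
  rewrite (bigD1 a)//= ga eqxx mul1r big1 ?addr0// => b /negbTE ba.
  by rewrite ga ba mul0r.
have tT : (t <= horizon M)%N by rewrite -tk leq_addr.
have [a ga] := greedyP h u0 tT.
have -> : (horizon M - t)%N = k.+1 by rewrite -tk addKn.
move=> <- /=.
rewrite (bigD1 a)//= ga eqxx mul1r [X in _ + X]big1 ?addr0; last first.
  by move=> b /negbTE ba; rewrite ga ba mul0r.
by apply: eq_bigr => s' _; rewrite ih//= addSnnS.
Qed.

(* Costs are only tested on the grid [j * eta]: monotonicity and the Lipschitz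
   property of the value function handle the costs in between. *)
Fixpoint good_samples (R : realType) (M : mdp R) (n : nat) (u : R -> R)
    (eta l : R) (K k t : nat) : pred (samples M n k t) :=
  match k return pred (samples M n k t) with
  | 0 => xpredT
  | k'.+1 => fun sg =>
      [forall s : state M t, forall a : action M t, forall j : 'I_K,
        \prod_(i < n) max_value u k' (t := t.+1) (sg.1 (s, a, i))
                        (j%:R * eta + cost M s a) <=
        expR l * (action_value u k'.+1 s (j%:R * eta) a) ^+ n] &&
      good_samples u eta l K sg.2
  end.
Arguments good_samples {R M n} u eta l K k t.

(** The value function depends only on the true kernel, so the product tested at [(s, a, j)] is over
    i.i.d. factors and has mean [action_value ^+ n]. By Markov's inequality each test fails with
    probability at most [expR (- l)]; a union bound counts the tests. *)
Lemma bad_samples_le (R : realType) (M : mdp R) (n : nat) (u : R -> R)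
    (eta l : R) (K S A : nat) :
  (forall z, 0 < u z) ->
  (forall t, (t <= horizon M)%N -> (#|state M t| <= S)%N) ->
  (forall t, (t <= horizon M)%N -> (#|action M t| <= A)%N) ->
  forall k t, (t + k)%N = horizon M ->
  \sum_(sg : samples M n k t | ~~ good_samples u eta l K k t sg)
    sample_weight sg <=
  (k * (S * A * K))%:R * expR (- l).
Proof.
move=> u0 hS hA; elim=> [|k ih] t tk.
  by rewrite big_pred0// mul0n mul0r.
have tT : (t < horizon M)%N by rewrite -tk -addSnnS leq_addr.
have tk' : (t.+1 + k)%N = horizon M by rewrite addSnnS.
pose bad (j : state M t * action M t * 'I_K) (om : layer M n t) :=
  ~~ (\prod_(i < n) max_value u k (t := t.+1) (om (j.1.1, j.1.2, i))
        (j.2%:R * eta + cost M j.1.1 j.1.2) <=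
      expR l * (action_value u k.+1 j.1.1 (j.2%:R * eta) j.1.2) ^+ n).
have mv0 (s' : state M t.+1) x : 0 < max_value u k (t := t.+1) s' x.
  exact: (max_value_gt0 u0 s' x tk').
have av0 (s : state M t) x a : 0 < action_value u k.+1 s x a.
  by apply: (distr_sum_gt0 (kernel_distr tT s a)) => s'; exact: mv0.
have bad_le j : \sum_(om | bad j om) layer_weight om <= expR (- l).
  case: j => -[s a] j.
  pose Y (om : layer M n t) := (\prod_(i < n) max_value u k (t := t.+1) (om (s, a, i))
        (j%:R * eta + cost M s a)) *
        (expR (- l) / (action_value u k.+1 s (j%:R * eta) a) ^+ n).
  have D0 : 0 < (action_value u k.+1 s (j%:R * eta) a) ^+ n by rewrite exprn_gt0.
  apply: (@le_trans _ _ (\sum_om layer_weight om * Y om)).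
    apply: mass_markov => [om|om|om].
    - exact: layer_weight_ge0.
    - rewrite mulr_ge0 ?divr_ge0 ?expR_ge0 ?(ltW D0)//.
      by apply: prodr_ge0 => i _; exact: ltW.
    - rewrite /bad -ltNge /= => /ltW h; rewrite /Y mulrA ler_pdivlMr// mul1r.
      by rewrite expRN ler_pdivlMr ?expR_gt0// mulrC.
  under eq_bigr => om _ do rewrite mulrA.
  rewrite -mulr_suml.
  rewrite (@prod_law_select _ _ _ _ (fun j => mdp_kernel M t j.1.1 j.1.2)
    (fun i => (s, a, i))
    (fun i x => max_value u k (t := t.+1) x (j%:R * eta + cost M s a))); first last.
  - by move=> i; rewrite (kernel_distr tT _ _).2.
  - by move=> i i' [].
  by rewrite /= prodr_const card_ord mulrCA mulfV ?mulr1// gt_eqF.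
have card_le : #|{: state M t * action M t * 'I_K}|%:R <= (S * A * K)%:R :> R.
  by rewrite ler_nat !card_prod card_ord !leq_mul// ?hS ?hA// ltnW.
(* A failure occurs in the layer at time [t] or in a later one; in each case the weights of the
   other samples sum to 1. *)
apply: (@le_trans _ _ (\sum_(om : layer M n t) \sum_(sg : samples M n k t.+1)
   ((([exists j, bad j om] : bool)%:R * layer_weight om * sample_weight sg) +
    (layer_weight om * ((~~ good_samples u eta l K k t.+1 sg)%:R * sample_weight sg))))).
  rewrite pair_bigA big_mkcond/=; apply: ler_sum => -[om sg] _ /=.
  have w1 : 0 <= layer_weight om by exact: layer_weight_ge0.
  have w2 : 0 <= sample_weight sg by rewrite sample_weight_ge0// tk'.
  rewrite negb_and; case: ifP => [|_]; last by rewrite addr_ge0 ?mulr_ge0.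
  move=> /orP[h|->]; last by rewrite mul1r lerDr !mulr_ge0.
  suff -> : [exists j, bad j om] by rewrite mul1r lerDl !mulr_ge0.
  move: h; apply: contraNT => /existsPn h.
  apply/forallP => s; apply/forallP => a; apply/forallP => j.
  by have := h (s, a, j); rewrite negbK.
under eq_bigr => om _.
  rewrite big_split/= -!mulr_sumr sample_weight_sum ?tk'// mulr1.
  over.
rewrite big_split/= -mulr_suml layer_weight_sum// mul1r mulSn natrD mulrDl.
apply: lerD; last first.
  rewrite (eq_bigr (fun sg => if ~~ good_samples u eta l K k t.+1 sg
      then sample_weight sg else 0)); last first.
    by move=> sg _; case: ifP => _; rewrite ?mul1r ?mul0r.
  by rewrite -big_mkcond/= ih.
rewrite (eq_bigr (fun om => if [exists j, bad j om] then layer_weight om else 0)); last first.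
  by move=> om _; case: ifP => _; rewrite ?mul1r ?mul0r.
rewrite -big_mkcond/=.
apply: le_trans (mass_exists _ _) _; first by move=> om; exact: layer_weight_ge0.
apply: le_trans (ler_sum _ (fun j _ => bad_le j)) _.
by rewrite sumr_const -[leLHS]mulr_natl ler_wpM2r// expR_ge0.
Qed.

Lemma action_value_gt0 (R : realType) (M : mdp R) (u : R -> R) (k t : nat)
    (s : state M t) (x : R) (a : action M t) :
  (forall z, 0 < u z) -> (t + k)%N = horizon M -> 0 < action_value u k s x a.
Proof.
move=> u0; case: k => [|k] tk; first exact: u0.
have tT : (t < horizon M)%N by rewrite -tk -addSnnS leq_addr.
apply: (distr_sum_gt0 (kernel_distr tT s a)) => s'.
by apply: max_value_gt0; rewrite // addSnnS.
Qed.

(** Induction on the time to go. Each step turns the mean of [ln] of the next value function into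
    [ln] of its expectation, at the price [l / n] for the test and [kap] for rounding the cost. The
    tests do not mention [pi], so one sample serves all policies. *)
Lemma sample_value_le_max_value (R : realType) (M : mdp R) (n : nat)
    (pi : policy M) (f : R -> R) (eta kap l : R) :
  (0 < n)%N -> is_policy pi -> 0 < eta ->
  (forall z z', z <= z' -> f z' <= f z) ->
  (forall z d, 0 <= d <= eta -> f z <= f (z + d) + kap) ->
  forall k t (h : history M t) (sg : samples M n k t), (t + k)%N = horizon M ->
  good_samples (fun z => expR (f z)) eta l
    (Num.truncn ((horizon M)%:R / eta)).+1 k t sg ->
  sample_value pi f h sg <=
  ln (max_value (fun z => expR (f z)) k (current_state h) (acc_cost h)) +
  k%:R * (l / n%:R + kap).
Proof.
move=> n0 pid eta0 f_anti f_lip; set u := fun z => expR (f z).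
have u0 z : 0 < u z by exact: expR_gt0.
elim=> [|k ih] t h sg tk.
  move=> _; rewrite mul0r addr0 /=.
  have pih : is_distr (pi t h) by apply: pid; rewrite -tk leq_addr.
  rewrite -[leRHS](distr_sum_const _ pih); apply: ler_sum => a _.
  apply: ler_wpM2l; first exact: pih.1.
  rewrite -[leLHS]expRK ler_ln ?posrE ?expR_gt0//.
    exact: (action_value_le u 0 (current_state h) (acc_cost h) a).
  exact: (max_value_gt0 u0 (current_state h) (acc_cost h) tk).
case: sg => om sg /= /andP[good_om good_sg].
have tT : (t < horizon M)%N by rewrite -tk -addSnnS leq_addr.
have tk' : (t.+1 + k)%N = horizon M by rewrite addSnnS.
have pih : is_distr (pi t h) by apply: pid; exact: ltnW.
set s := current_state h; set x := acc_cost h.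
rewrite -[leRHS](distr_sum_const _ pih); apply: ler_sum => a _.
apply: ler_wpM2l; first exact: pih.1.
have n_gt0 : 0 < n%:R :> R by rewrite ltr0n.
pose mv (s' : state M t.+1) y := max_value u k s' (y + cost M s a).
have mv0 s' y : 0 < mv s' y by exact: (max_value_gt0 u0 _ _ tk').
(* The accumulated cost is rounded down to the grid; being at most [t], it stays within the index
   range. *)
have [j [jx xj]] : exists j : 'I_(Num.truncn ((horizon M)%:R / eta)).+1,
    j%:R * eta <= x /\ x <= j%:R * eta + eta.
  have /andP[x0 xt] : 0 <= x <= t%:R by apply: acc_cost_itv; rewrite ltnW// ltnS ltnW.
  have jP : (Num.truncn (x / eta) < (Num.truncn ((horizon M)%:R / eta)).+1)%N.
    rewrite ltnS le_truncn// ler_pM2r ?invr_gt0// (le_trans xt)// ler_nat.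
    exact: ltnW.
  exists (Ordinal jP) => /=.
  have /andP[h1 h2] := truncn_itv (divr_ge0 x0 (ltW eta0)).
  rewrite ler_pdivlMr// in h1; rewrite ltr_pdivrMr// in h2.
  by split=> //; rewrite -[X in _ + X]mul1r -mulrDl natr1 ltW.
set y := j%:R * eta in jx xj.
(* The value function is larger at the smaller cost [y], the direction in which the test at [y] is
   used; returning from [y] to [x] costs the factor [expR kap]. *)
have mv_xy s' : mv s' x <= mv s' y.
  rewrite /mv -[leRHS]mul1r (_ : y + _ = x + cost M s a + (y - x)); last by ring.
  apply: (max_value_shift _ u0) tk' => // z; rewrite mul1r ler_expR.
  by apply: f_anti; lra.
have av_yx : action_value u k.+1 s y a <= expR kap * action_value u k.+1 s x a.
  rewrite /= mulr_sumr; apply: ler_sum => s' _; rewrite mulrCA.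
  rewrite ler_wpM2l ?(kernel_distr tT _ _).1//.
  rewrite (_ : x + _ = y + cost M s a + (x - y)); last by ring.
  apply: (max_value_shift (expR_ge0 _) u0) tk' => z.
  rewrite /u -expRD ler_expR addrC; apply: f_lip.
  by apply/andP; split; lra.
have avx0 := action_value_gt0 s x a u0 tk.
have avy0 := action_value_gt0 s y a u0 tk.
have sum_ln : \sum_(i < n) ln (mv (om (s, a, i)) x) <=
    l + n%:R * (kap + ln (action_value u k.+1 s x a)).
  rewrite -ler_expR expR_sum.
  apply: (@le_trans _ _ (\prod_(i < n) mv (om (s, a, i)) y)).
    by apply: ler_prod => i _; rewrite lnK ?posrE// mv_xy ltW.
  have := forallP good_om s => /forallP/(_ a)/forallP/(_ j) h1.
  apply: (le_trans h1); rewrite expRD ler_wpM2l ?expR_ge0// expRM_natl expRD.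
  rewrite lnK ?posrE// lerXn2r ?nnegrE ?(ltW avy0)//.
  by rewrite mulr_ge0 ?expR_ge0// ltW.
have sv_le : (\sum_(i < n) sample_value pi f (t := t.+1) (h, a, om (s, a, i)) sg) <=
    n%:R * (k%:R * (l / n%:R + kap)) + \sum_(i < n) ln (mv (om (s, a, i)) x).
  rewrite mulr_natl -[X in _ *+ X](card_ord n) -sumr_const -big_split/=.
  apply: ler_sum => i _; rewrite addrC.
  exact: (ih t.+1 (h, a, om (s, a, i)) sg tk' good_sg).
rewrite ler_pdivrMr//; apply: (le_trans sv_le).
apply: le_trans (lerD (lexx _) sum_ln) _.
have ln_le : ln (action_value u k.+1 s x a) <= ln (max_value u k.+1 s x).
  by rewrite ler_ln ?posrE// ?(max_value_gt0 u0 _ _ tk) ?action_value_le.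
rewrite -/(max_value u k.+1 s x).
rewrite [leRHS](_ : _ = n%:R * (k%:R * (l / n%:R + kap)) +
  (l + n%:R * (kap + ln (max_value u k.+1 s x)))); last first.
  by rewrite -natr1; field; rewrite gt_eqF.
by rewrite lerD2l lerD2l ler_wpM2l// lerD2l.
Qed.

(** The greedy policy attains the value function of [expR (- th * F)] under the true kernel.
    Hoeffding's lemma replaces its logarithm by [- th] times the mean of [F], and dividing by [th]
    gives the comparison. *)
Lemma greedy_value_le (R : realType) (M : mdp R) (n : nat) (pi : policy M)
    (F : R -> R) (G th eta l : R) (s : state M 0)
    (sg : samples M n (horizon M) 0) :
  (0 < n)%N -> is_policy pi -> 0 < eta -> 0 < th -> 0 <= G ->
  th * (G * (horizon M).+1%:R) <= 2^-1 ->
  (forall z z', z <= z' -> F z <= F z') ->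
  (forall z z', z <= z' -> F z' <= F z + G * (z' - z)) ->
  good_samples (fun z => expR (- th * F z)) eta l
    (Num.truncn ((horizon M)%:R / eta)).+1 (horizon M) 0 sg ->
  value (mdp_kernel M) (greedy (fun z => expR (- th * F z))) F (horizon M) (t := 0) s <=
  sample_value pi F (t := 0) s sg + 2 * th * (G * (horizon M).+1%:R) ^+ 2 +
  (horizon M)%:R * (l / (n%:R * th) + G * eta).
Proof.
move=> n0 pid eta0 th0 G0 thr F_mono F_lip good.
set u := fun z => expR (- th * F z); set T := (horizon M)%:R.
have u0 z : 0 < u z by exact: expR_gt0.
have Pd : is_kernel (mdp_kernel M) by move=> v vT x a; exact: kernel_distr.
have gd : is_policy (greedy (M := M) u) by exact: greedy_policy.
set V := value _ _ _ _ _; set r := G * _ in thr *.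
have n_gt0 : 0 < n%:R :> R by rewrite ltr0n.
have h1 : - th * sample_value pi F (t := 0) s sg <=
    ln (max_value u (horizon M) (t := 0) s 0) + T * (l / n%:R + th * (G * eta)).
  rewrite -sample_value_scale.
  apply: (sample_value_le_max_value n0 pid eta0 _ _ _ (add0n _) good).
    by move=> z z' zz'; have := F_mono _ _ zz'; nra.
  move=> z d /andP[d0 de]; have := F_lip z (z + d) ltac:(lra).
  rewrite addrAC subrr add0r => h.
  have : G * d <= G * eta by rewrite ler_wpM2l.
  nra.
have h2 : ln (max_value u (horizon M) (t := 0) s 0) <= - th * V + 2 * (th * r) ^+ 2.
  rewrite -(greedy_value u0 (t := 0) s (add0n _)) -[leRHS]expRK.
  rewrite ler_ln ?posrE ?expR_gt0//; last by apply: value_gt0.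
  have := @value_expR_le _ _ (mdp_kernel M) (greedy u) (fun z => - th * F z)
    (- th * F (horizon M).+1%:R) (th * r) Pd gd thr _ (horizon M) 0 s (add0n _).
  have -> : value (mdp_kernel M) (greedy u) (fun z => - th * F z) (horizon M)
      (t := 0) s = - th * V.
    have := value_affine F (- th) 0 Pd gd (t := 0) s (add0n _).
    by rewrite addr0 => <-; under [in RHS]eq_fun do rewrite addr0.
  apply=> z /andP[z0 zZ]; have := F_mono _ _ zZ; have := F_lip _ _ zZ.
  have : G * ((horizon M).+1%:R - z) <= r by rewrite /r ler_wpM2l//; lra.
  move=> a1 a2 a3; apply/andP; split; nra.
rewrite -(ler_pM2l th0).
have -> : th * (sample_value pi F (t := 0) s sg + 2 * th * r ^+ 2 +
    T * (l / (n%:R * th) + G * eta)) =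
  th * sample_value pi F (t := 0) s sg + 2 * (th * r) ^+ 2 +
    T * (l / n%:R + th * (G * eta)).
  by field; rewrite !gt_eqF.
lra.
Qed.

(** * Sample complexity *)

Lemma abse_sub_le (R : realType) (a b : \bar R) (e : R) :
  a \is a fin_num -> b \is a fin_num ->
  (a <= b + e%:E)%E -> (b <= a + e%:E)%E -> (`|a - b| <= e%:E)%E.
Proof.
case: a b => [a| |] [b| |]//= _ _; rewrite -!EFinD !lee_fin => h1 h2.
by rewrite ler_norml; apply/andP; split; lra.
Qed.

Lemma fin_num_itv (R : realType) (a : \bar R) (Z : R) :
  (0 <= a)%E -> (a <= Z%:E)%E -> a \is a fin_num.
Proof. by case: a. Qed.

Lemma abse_sub_le_itv (R : realType) (a b : \bar R) (Z e : R) :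
  (0 <= a <= Z%:E)%E -> (0 <= b <= Z%:E)%E -> Z <= e -> (`|a - b| <= e%:E)%E.
Proof.
move=> /andP[a0 aZ] /andP[b0 bZ] Ze.
apply: abse_sub_le; [exact: fin_num_itv aZ|exact: fin_num_itv bZ| |].
  by apply: (le_trans aZ); apply: le_trans (leeD2r _ b0); rewrite add0e lee_fin.
by apply: (le_trans bZ); apply: le_trans (leeD2r _ a0); rewrite add0e lee_fin.
Qed.

Section comparison.
Variables (R : realType) (M : mdp R) (phi : R -> \bar R) (tau eps y0 : R).
Hypotheses (phid : is_divergence phi) (tau_gt0 : 0 < tau) (eps_gt0 : 0 < eps).
Let Z : R := (horizon M).+1%:R.
Hypothesis Zy0 : Z <= eps / (8 * tau) * y0.
Let F := grid_integrand phi tau eps Z.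

Lemma risk_itv (P : transition R (state M) (action M)) (pi : policy M)
    (s : state M 0) : is_kernel P -> is_policy pi ->
  (0 <= risk P phi tau pi s <= Z%:E)%E.
Proof. by move=> Pd pid; rewrite risk_ge0//= risk_le_total. Qed.

Lemma risk_compare (P P' : transition R (state M) (action M)) (pi : policy M)
    (s : state M 0) (e : R) : is_kernel P -> is_kernel P' -> is_policy pi ->
  (forall j k : 'I_(grid_size eps Z),
     value P pi (F j k) (horizon M) (t := 0) s <=
     value P' pi (F j k) (horizon M) (t := 0) s + e) ->
  (risk P phi tau pi s <= risk P' phi tau pi s + (e + eps / 4)%:E)%E.
Proof.
move=> Pd P'd pid h.
have /andP[r0 rZ] := risk_itv s Pd pid.
have /fineK rE := fin_num_itv r0 rZ.
rewrite -rE -leeBlDr// -EFinB opprD addrA.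
apply: (risk_ge_grid (y0 := y0)) => // j k; rewrite lerBlDr.
by apply: le_trans (h j k); rewrite -lee_fin rE; exact: (risk_le_grid (y0 := y0)).
Qed.

Lemma optimal_risk_le (P : transition R (state M) (action M)) (pi : policy M)
    (s : state M 0) : is_policy pi ->
  (optimal_risk P phi tau s <= risk P phi tau pi s)%E.
Proof. by move=> pid; apply: ge_ereal_inf; exists (risk P phi tau pi s) => //; exists pi. Qed.

Lemma optimal_risk_itv (P : transition R (state M) (action M)) (s : state M 0) :
  is_kernel P -> (0 <= optimal_risk P phi tau s <= Z%:E)%E.
Proof.
move=> Pd; apply/andP; split.
  by apply/ereal_infP => _ [pi pid <-]; have /andP[] := risk_itv s Pd pid.
(* Any policy bounds the infimum from above; the greedy one for a constant utility shows that one
   exists. *)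
have gd : is_policy (greedy (M := M) (fun=> 1 : R)) by apply: greedy_policy.
apply: (le_trans (optimal_risk_le _ s gd)).
by have /andP[] := risk_itv s Pd gd.
Qed.

(** The optimal risk is an infimum, so a policy within [e] of it is chosen separately for each
    initial state. *)
Lemma near_optimal_policy (P : transition R (state M) (action M)) (e : R) :
  is_kernel P -> 0 < e ->
  exists pi : state M 0 -> policy M, forall s, is_policy (pi s) /\
    (risk P phi tau (pi s) s <= optimal_risk P phi tau s + e%:E)%E.
Proof.
move=> Pd e0; suff : forall s, exists pi : policy M, is_policy pi /\
    (risk P phi tau pi s <= optimal_risk P phi tau s + e%:E)%E.
  by move=> /boolp.choice[pi h]; exists pi.
move=> s.
have /andP[r0 rZ] := optimal_risk_itv s Pd.
have [_ [pi pid <-] h] := lb_ereal_inf_adherent e0 (fin_num_itv r0 rZ).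
by exists pi; split=> //; exact: ltW.
Qed.

End comparison.

(** * Arithmetic of the union bounds *)

Lemma expR_neg_ln (R : realType) (Q x : R) (k : nat) :
  0 < Q -> k%:R * ln Q <= x -> expR (- x) <= (Q ^+ k)^-1.
Proof.
move=> Q0 kQ; rewrite expRN lef_pV2 ?posrE ?expR_gt0 ?exprn_gt0//.
by rewrite -[in leLHS](lnK (x := Q)) ?posrE// -expRM_natl ler_expR.
Qed.

(** Here [Q] is the argument of the logarithm, and [m] and [tau2] are 1/eps and tau read as at least
    2. The factor [tau2] gives the 2 on the left; the remaining factors are at least 1. *)
Lemma log_arg_bounds (R : realType) (T nS nA G tau2 m delta Q : R) :
  1 <= T -> 1 <= nS -> 1 <= nA -> 1 <= G -> 2 <= tau2 -> 2 <= m ->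
  0 < delta -> delta < 1 -> T * nS * nA * tau2 * G * m <= Q * delta ->
  [/\ 4 <= Q, nS <= Q * delta, 2 * (T * m) <= Q &
  2 * (T * nS * nA * G * m) <= Q * delta].
Proof.
move=> T1 S1 A1 G1 tau2_ge m2 delta0 delta1 QE.
have h1 : 1 <= T * nS by rewrite mulr_ege1.
have h2 : 1 <= T * nS * nA by rewrite mulr_ege1.
have h3 : 1 <= T * nS * nA * G by rewrite mulr_ege1.
have m0 : 0 <= m by lra.
have h4 : 2 * (T * nS * nA * G * m) <= Q * delta.
  apply: le_trans QE.
  rewrite (_ : T * nS * nA * tau2 * G * m = tau2 * (T * nS * nA * G * m)); last by ring.
  by rewrite ler_wpM2r// mulr_ge0// (le_trans ler01).
have Tm : T * m <= T * nS * nA * G * m.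
  rewrite ler_wpM2r// -!mulrA ler_peMr//; first lra.
  by rewrite mulr_ege1// mulr_ege1.
have Tm2 : 2 <= T * m.
  by rewrite -[leLHS]mul1r ler_pM// ?ler01.
have Qd : 2 * (T * m) <= Q * delta by lra.
have Q0 : 0 < Q by rewrite -(pmulr_lgt0 _ delta0); lra.
have QQ : Q * delta <= Q by rewrite ler_piMr// ltW.
split=> //; try lra.
apply: le_trans h4.
rewrite (_ : 2 * _ = nS * (T * nA * G * (2 * m))); last by ring.
rewrite ler_peMr//; first lra.
rewrite mulr_ege1//; last lra.
by rewrite mulr_ege1// mulr_ege1.
Qed.

Lemma union_bound_tail (R : realType) (T nS nA G tau2 m delta Q J : R) :
  1 <= T -> 1 <= nS -> 1 <= nA -> 1 <= G -> 2 <= tau2 -> 2 <= m ->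
  0 < delta -> delta < 1 -> T * nS * nA * tau2 * G * m <= Q * delta ->
  0 <= J -> J <= 17 * (T * m) ->
  nS * (J * J) * (2 * (Q ^+ 9)^-1) <= delta / 2.
Proof.
move=> T1 S1 A1 G1 tau2_ge m2 delta0 delta1 QE J0 JT.
have [Q4 SQ TmQ _] := log_arg_bounds T1 S1 A1 G1 tau2_ge m2 delta0 delta1 QE.
have Q0 : 0 < Q by lra.
have JQ : J <= 9 * Q by lra.
rewrite [leLHS]mulrA ler_pdivrMr ?exprn_gt0//.
apply: (@le_trans _ _ (Q * delta * ((9 * Q) * (9 * Q)) * 2)).
  rewrite ler_pM2r// ler_pM//; first lra.
    by rewrite mulr_ge0.
  by rewrite ler_pM.
have h : 4 ^+ 6 <= Q ^+ 6 by rewrite lerXn2r// nnegrE; lra.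
rewrite (_ : Q * delta * _ * 2 = 162 * (delta * Q ^+ 3)); last by ring.
rewrite (_ : delta / 2 * Q ^+ 9 = Q ^+ 6 / 2 * (delta * Q ^+ 3)); last by field.
rewrite ler_pM2r ?mulr_gt0 ?exprn_gt0//.
lra.
Qed.

(** This count fixes the exponent 9: the number of tests is at most a constant times
    [delta * Q ^+ 5], and the other four powers, with [Q >= 4], absorb the constant. *)
Lemma union_bound_dp (R : realType) (T nS nA G tau2 m delta Q J K : R) :
  1 <= T -> 1 <= nS -> 1 <= nA -> 1 <= G -> 2 <= tau2 -> 2 <= m ->
  0 < delta -> delta < 1 -> T * nS * nA * tau2 * G * m <= Q * delta ->
  0 <= J -> J <= 17 * (T * m) ->
  0 <= K -> K <= 9 * (G * T ^+ 2 * m) ->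
  (J * J) * (T * (nS * nA * K) * (Q ^+ 9)^-1) <= delta / 2.
Proof.
move=> T1 S1 A1 G1 tau2_ge m2 delta0 delta1 QE J0 JT K0 KT.
have [Q4 SQ TmQ TQ] := log_arg_bounds T1 S1 A1 G1 tau2_ge m2 delta0 delta1 QE.
have Q0 : 0 < Q by lra.
have T0 : 0 <= T by lra.
have m0 : 0 <= m by lra.
have Tm0 : 0 <= T * m by rewrite mulr_ge0.
rewrite [leLHS]mulrA ler_pdivrMr ?exprn_gt0//.
apply: (@le_trans _ _ ((17 * (T * m)) * (17 * (T * m)) *
    (T * (nS * nA * (9 * (G * T ^+ 2 * m)))))).
  have SA0 : 0 <= nS * nA by rewrite mulr_ge0//; lra.
  have SAK0 : 0 <= nS * nA * K by rewrite mulr_ge0.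
  apply: ler_pM; [by rewrite mulr_ge0|by rewrite mulr_ge0|exact: ler_pM|].
  by rewrite ler_wpM2l// ler_wpM2l.
rewrite (_ : _ * _ = 2601 * (T * nS * nA * G * m * ((T * m) ^+ 2 * T ^+ 2))); last by ring.
have TTm : T <= T * m by rewrite ler_peMr//; lra.
have h3 : T ^+ 2 <= (T * m) ^+ 2 by rewrite lerXn2r// nnegrE.
have h4 : (T * m) ^+ 2 <= (Q / 2) ^+ 2.
  by rewrite lerXn2r ?nnegrE//; [lra|lra].
have sq0 (x : R) : 0 <= x ^+ 2 by exact: sqr_ge0.
have X0 : 0 <= T * nS * nA * G * m by rewrite !mulr_ge0//; lra.
have h5 : T * nS * nA * G * m * ((T * m) ^+ 2 * T ^+ 2) <=
    Q * delta / 2 * ((Q / 2) ^+ 2 * (Q / 2) ^+ 2).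
  apply: ler_pM => //; [by rewrite mulr_ge0|lra|].
  by apply: ler_pM => //; exact: le_trans h4.
rewrite (_ : Q * delta / 2 * _ = delta * Q ^+ 5 / 32) in h5; last by field.
have h : 4 ^+ 4 <= Q ^+ 4 by rewrite lerXn2r// nnegrE; lra.
have D0 : 0 <= delta * Q ^+ 5 by rewrite mulr_ge0 ?exprn_ge0// ltW.
have h6 : 4 ^+ 4 * (delta * Q ^+ 5) <= Q ^+ 4 * (delta * Q ^+ 5) by rewrite ler_wpM2r.
rewrite (_ : delta / 2 * Q ^+ 9 = Q ^+ 4 * (delta * Q ^+ 5) / 2); last by field.
lra.
Qed.

Section deviation.
Variables (R : realType) (M : mdp R) (phi : R -> \bar R) (tau eps y0 : R).
Hypotheses (phid : is_divergence phi) (tau_gt0 : 0 < tau) (eps_gt0 : 0 < eps).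
Let Z : R := (horizon M).+1%:R.
Hypotheses (Zy0 : Z <= eps / (8 * tau) * y0) (eps_le : eps <= Z).
Let F := grid_integrand phi tau eps Z.
Let J := grid_size eps Z.
Let G := growth_inv phi y0.

(** The policy may depend on the initial state, so that this covers both a fixed policy and a family
    of near-optimal ones. *)
Definition deviates (n : nat) (pi : state M 0 -> policy M)
    (x : state M 0 * 'I_J * 'I_J) : pred (samples M n (horizon M) 0) :=
  fun sg => eps / 2 <
    `|sample_value (pi x.1.1) (F x.1.2 x.2) (t := 0) x.1.1 sg -
      value (mdp_kernel M) (pi x.1.1) (F x.1.2 x.2) (horizon M) (t := 0) x.1.1|.

Lemma deviation_mass (n : nat) (pi : state M 0 -> policy M) (Q : R) :
  (0 < n)%N -> (forall s, is_policy (pi s)) -> 0 < Q ->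
  9 * ln Q <= n%:R * (eps / 2) ^+ 2 / (8 * (G * Z) ^+ 2) ->
  \sum_(sg : samples M n (horizon M) 0 | [exists x, deviates pi x sg])
    sample_weight sg <=
  (num_states M)%:R * (J%:R * J%:R) * (2 * (Q ^+ 9)^-1).
Proof.
move=> n0 pid Q0 hQ.
have Z0 : 0 < Z by rewrite ltr0n.
have G1 : 1 <= G by exact: growth_inv_ge1.
have GZ : Z <= G * Z by rewrite ler_peMl// ltW.
apply: le_trans (mass_exists _ _) _; first by move=> sg; exact: sample_weight_ge0.
have tail x : \sum_(sg | deviates pi x sg) sample_weight (n := n) sg <=
    2 * (Q ^+ 9)^-1.
  have GZ0 : 0 < G * Z by exact: lt_le_trans GZ.
  have e2 : 0 < eps / 2 <= 2 * (G * Z).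
    have h := eps_le; have h' := eps_gt0; by apply/andP; split; lra.
  have Fm z : 0 <= z <= Z -> F x.1.2 x.2 0 <= F x.1.2 x.2 z <= F x.1.2 x.2 0 + G * Z.
    move=> /andP[z0 zZ]; apply/andP; split.
      by apply: (grid_integrand_mono (y0 := y0)) => //; exact: ltW.
    have := grid_integrand_lipschitz phid tau_gt0 eps_gt0 (ltW Z0) Zy0 x.1.2 x.2 z0.
    rewrite -/G subr0 => /le_trans; apply; rewrite lerD2l ler_wpM2l//.
    by rewrite (le_trans ler01).
  apply: le_trans (sample_value_tail x.1.1 n0 (pid _) GZ0 e2 Fm) _.
  by rewrite ler_wpM2l//; exact: expR_neg_ln.
apply: le_trans (ler_sum _ (fun x _ => tail x)) _.
rewrite sumr_const -[leLHS]mulr_natl ler_wpM2r//.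
  by rewrite mulr_ge0// invr_ge0 exprn_ge0// ltW.
rewrite -!natrM ler_nat !card_prod !card_ord -mulnA leq_mul2r; apply/orP; right.
exact: (leq_bigmax (F := fun t : 'I_(horizon M).+1 => #|state M t|) ord0).
Qed.

(** The deviation of the grid values costs [eps / 2] and the grid [eps / 4]; the last [eps / 4]
    leaves room for near-optimality. *)
Lemma risk_close (n : nat) (Omega : Type) (xi : sampling M n Omega) (w : Omega)
    (pi : state M 0 -> policy M) (s : state M 0) :
  (0 < n)%N -> (forall s, is_policy (pi s)) ->
  ~~ [exists x, deviates pi x (draw xi w (horizon M) 0)] ->
  (risk (empirical_kernel xi w) phi tau (pi s) s <=
   risk (mdp_kernel M) phi tau (pi s) s + (eps / 2 + eps / 4)%:E)%E /\
  (risk (mdp_kernel M) phi tau (pi s) s <=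
   risk (empirical_kernel xi w) phi tau (pi s) s + (eps / 2 + eps / 4)%:E)%E.
Proof.
move=> n0 pid /existsPn good.
have Pd : is_kernel (mdp_kernel M) by move=> v vT x a; exact: kernel_distr.
have Pd' := empirical_kernel_distr xi w n0.
have h (j k : 'I_J) :
  `|value (empirical_kernel xi w) (pi s) (F j k) (horizon M) (t := 0) s -
    value (mdp_kernel M) (pi s) (F j k) (horizon M) (t := 0) s| <= eps / 2.
  by rewrite value_empirical leNgt; exact: (good (s, j, k)).
split; apply: (risk_compare (y0 := y0)) => // j k;
  by have := h j k; rewrite ler_norml => /andP[h1 h2]; rewrite -/Z -/F; lra.
Qed.

End deviation.
Arguments deviates {R M} phi tau eps {n} pi x.

Lemma grid_size_le (R : realType) (T eps Z m : R) :
  1 <= T -> 0 < eps -> 0 <= Z -> Z <= 2 * T -> eps^-1 <= m -> 2 <= m ->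
  (grid_size eps Z)%:R <= 17 * (T * m).
Proof.
move=> T1 e0 Z0 ZT em m2.
have h : (Num.truncn (8 * Z / eps))%:R <= 8 * Z / eps.
  by rewrite truncn_le divr_ge0 ?mulr_ge0// ltW.
have h2 : 8 * Z / eps <= 16 * T * m.
  by apply: ler_pM => //; [rewrite mulr_ge0|rewrite invr_ge0 ltW|lra].
rewrite /grid_size -natr1; nra.
Qed.

(** Since [G * Z <= 2 * (G * T)], the right side is at least [n eps^2 / (128 G^2 T^2)], and
    [9 * 128 <= 5000]. *)
Lemma tail_exponent (R : realType) (C T G Z eps L n : R) :
  5000 <= C -> 1 <= T -> 1 <= G -> 0 < eps -> 0 < Z -> Z <= 2 * T -> 0 <= L ->
  C * (T ^+ 2 * G ^+ 2 / eps ^+ 2) * L <= n ->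
  9 * L <= n * (eps / 2) ^+ 2 / (8 * (G * Z) ^+ 2).
Proof.
move=> C5000 T1 G1 e0 Z0 ZT L0 hn.
have G0 : 0 < G := lt_le_trans ltr01 G1.
have GZ0 : 0 < G * Z by rewrite mulr_gt0.
have GZ : (G * Z) ^+ 2 <= 4 * (T ^+ 2 * G ^+ 2).
  rewrite (_ : 4 * _ = (G * (2 * T)) ^+ 2); last by ring.
  rewrite lerXn2r ?nnegrE ?(ltW GZ0)//; first by rewrite mulr_ge0//; lra.
  by rewrite ler_wpM2l// ltW.
rewrite ler_pdivlMr ?mulr_gt0 ?exprn_gt0//.
have e20 : 0 < eps ^+ 2 by rewrite exprn_gt0.
have hn' : C * (T ^+ 2 * G ^+ 2) * L <= n * eps ^+ 2.
  rewrite -ler_pdivrMr//; apply: le_trans hn.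
  by rewrite le_eqVlt; apply/orP; left; apply/eqP; field; rewrite gt_eqF.
have h : L * (G * Z) ^+ 2 <= L * (4 * (T ^+ 2 * G ^+ 2)) by rewrite ler_wpM2l.
have h0 : 0 <= T ^+ 2 * G ^+ 2 * L by rewrite mulr_ge0// mulr_ge0// sqr_ge0.
have h1 : 5000 * (T ^+ 2 * G ^+ 2 * L) <= C * (T ^+ 2 * G ^+ 2 * L).
  by rewrite ler_wpM2r.
rewrite (_ : n * (eps / 2) ^+ 2 = n * eps ^+ 2 / 4); last by field.
lra.
Qed.

(** The choices [th = eps / (64 (G T)^2)] and [eta = eps / (8 G T)] make each of three errors at
    most [eps / 8]: Hoeffding's lemma, the level of the tests, and the rounding of costs. The second
    requires [C >= 8 * 9 * 64 = 4608]. *)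
Lemma greedy_exponent (R : realType) (C T G Z eps L n : R) :
  5000 <= C -> 1 <= T -> 1 <= G -> 0 < eps -> 0 < Z -> Z <= 2 * T -> 0 < n ->
  C * (T ^+ 3 * G ^+ 2 / eps ^+ 2) * L <= n -> 0 <= L ->
  2 * (eps / (64 * (G * T) ^+ 2)) * (G * Z) ^+ 2 +
  T * (9 * L / (n * (eps / (64 * (G * T) ^+ 2))) + G * (eps / (8 * (G * T)))) <=
  3 * eps / 8.
Proof.
move=> C5000 T1 G1 e0 Z0 ZT n0 hn L0.
have T0 : 0 < T := lt_le_trans ltr01 T1.
have G0 : 0 < G := lt_le_trans ltr01 G1.
have GZ : (G * Z) ^+ 2 <= (2 * (G * T)) ^+ 2.
  rewrite lerXn2r ?nnegrE//; [exact/ltW/mulr_gt0| |].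
    by rewrite mulr_ge0// ltW// mulr_gt0.
  by rewrite mulrCA ler_pM2l.
have W0 : 0 < (G * T) ^+ 2 by rewrite exprn_gt0// mulr_gt0.
have a1 : 2 * (eps / (64 * (G * T) ^+ 2)) * (G * Z) ^+ 2 <= eps / 8.
  have : 2 * (eps / (64 * (G * T) ^+ 2)) * (G * Z) ^+ 2 <=
      2 * (eps / (64 * (G * T) ^+ 2)) * (2 * (G * T)) ^+ 2.
    by rewrite ler_wpM2l// mulr_ge0// divr_ge0 ?mulr_ge0// ltW.
  move/le_trans; apply; rewrite le_eqVlt; apply/orP; left; apply/eqP.
  by field; rewrite !gt_eqF.
have a2 : T * (G * (eps / (8 * (G * T)))) = eps / 8.
  by field; rewrite !gt_eqF.
have a3 : T * (9 * L / (n * (eps / (64 * (G * T) ^+ 2)))) <= eps / 8.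
  rewrite (_ : T * _ = 576 * (T ^+ 3 * G ^+ 2 * L) / (n * eps)); last first.
    by field; rewrite !gt_eqF.
  rewrite ler_pdivrMr ?mulr_gt0//.
  have : C * (T ^+ 3 * G ^+ 2) * L <= n * eps ^+ 2.
    rewrite -ler_pdivrMr ?exprn_gt0//; apply: le_trans hn.
    by rewrite le_eqVlt; apply/orP; left; apply/eqP; field; rewrite gt_eqF.
  have h0 : 0 <= T ^+ 3 * G ^+ 2 * L.
    by rewrite !mulr_ge0// ?exprn_ge0// ltW.
  have h1 : 5000 * (T ^+ 3 * G ^+ 2 * L) <= C * (T ^+ 3 * G ^+ 2 * L).
    by rewrite ler_wpM2r.
  rewrite (_ : eps / 8 * (n * eps) = n * eps ^+ 2 / 8); last by field.
  lra.
by rewrite mulrDr a2; lra.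
Qed.

Section greedy_deviation.
Variables (R : realType) (M : mdp R) (phi : R -> \bar R) (tau eps y0 : R).
Hypotheses (phid : is_divergence phi) (tau_gt0 : 0 < tau) (eps_gt0 : 0 < eps).
Let T : R := (horizon M)%:R.
Let Z : R := (horizon M).+1%:R.
Hypotheses (Zy0 : Z <= eps / (8 * tau) * y0) (eps_le : eps <= Z).
Let F := grid_integrand phi tau eps Z.
Let J := grid_size eps Z.
Let G := growth_inv phi y0.
Let th := eps / (64 * (G * T) ^+ 2).
Let eta := eps / (8 * (G * T)).
Let K := (Num.truncn (T / eta)).+1.

Let T1 : 1 <= T. Proof. by rewrite ler1n horizon_gt0. Qed.
Let G1 : 1 <= G. Proof. exact: growth_inv_ge1. Qed.
Let ZT : Z <= 2 * T.
Proof. by rewrite /Z -natr1 -/T; have := T1; lra. Qed.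
Let GT0 : 0 < G * T.
Proof. by rewrite mulr_gt0// (lt_le_trans ltr01)// ?T1 ?G1. Qed.

(** With [L = ln Q], the level [9 * L] gives each test a failure probability of at most [Q^-9]. *)
Definition greedy_fails (n : nat) (L : R) (x : 'I_J * 'I_J) :
    pred (samples M n (horizon M) 0) :=
  fun sg => ~~ good_samples (fun z => expR (- th * F x.1 x.2 z)) eta (9 * L) K
    (horizon M) 0 sg.

Lemma greedy_fails_mass (n : nat) (Q : R) : 0 < Q ->
  \sum_(sg | [exists x, @greedy_fails n (ln Q) x sg]) sample_weight sg <=
  (J%:R * J%:R) *
  (T * ((num_states M)%:R * (num_actions M)%:R * K%:R) * (Q ^+ 9)^-1).
Proof.
move=> Q0.
apply: le_trans (mass_exists _ _) _; first by move=> sg; exact: sample_weight_ge0.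
have fail x : \sum_(sg | @greedy_fails n (ln Q) x sg) sample_weight sg <=
    T * ((num_states M)%:R * (num_actions M)%:R * K%:R) * (Q ^+ 9)^-1.
  have hS t : (t <= horizon M)%N -> (#|state M t| <= num_states M)%N.
    rewrite -ltnS => tT.
    exact: (leq_bigmax (F := fun t : 'I_(horizon M).+1 => #|state M t|) (Ordinal tT)).
  have hA t : (t <= horizon M)%N -> (#|action M t| <= num_actions M)%N.
    rewrite -ltnS => tT.
    exact: (leq_bigmax (F := fun t : 'I_(horizon M).+1 => #|action M t|) (Ordinal tT)).
  have u0 z : 0 < expR (- th * F x.1 x.2 z) by exact: expR_gt0.
  apply: le_trans (bad_samples_le n eta (9 * ln Q) K u0 hS hA (add0n _)) _.
  rewrite !natrM; apply: ler_wpM2l; first by rewrite !mulr_ge0.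
  by apply: expR_neg_ln.
apply: le_trans (ler_sum _ (fun x _ => fail x)) _.
by rewrite sumr_const card_prod card_ord -[leLHS]mulr_natl natrM.
Qed.

Lemma greedy_size_le (m : R) : eps^-1 <= m -> 2 <= m ->
  K%:R <= 9 * (G * T ^+ 2 * m).
Proof.
move=> em m2.
have T1' := T1; have G1' := G1; have e0 := eps_gt0.
have T0 : 0 < T by lra.
have G0 : 0 < G by lra.
have eta0 : 0 < eta by rewrite divr_gt0// mulr_gt0.
have h : (Num.truncn (T / eta))%:R <= T / eta.
  by rewrite truncn_le divr_ge0// ltW.
have X1 : 1 <= G * T ^+ 2 by rewrite mulr_ege1// exprn_ege1.
have X0 : 0 <= G * T ^+ 2 by lra.
have h2 : T / eta <= 8 * (G * T ^+ 2 * m).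
  rewrite (_ : T / eta = 8 * (G * T ^+ 2 * eps^-1)); last first.
    by rewrite /eta; field; rewrite !gt_eqF.
  by rewrite ler_pM2l// ler_wpM2l.
have h3 : 1 <= G * T ^+ 2 * m by rewrite mulr_ege1//; lra.
rewrite /K -natr1; lra.
Qed.

(** The greedy policy varies with the grid point, which is allowed because the optimal risk lies
    below every grid value of every policy. The total loss is [3 * eps / 8 + eps / 4]. *)
Lemma optimal_risk_lower (C : R) (n : nat) (L : R) (Omega : Type)
    (xi : sampling M n Omega) (w : Omega) (s : state M 0) :
  5000 <= C -> (0 < n)%N -> 0 <= L ->
  C * (T ^+ 3 * G ^+ 2 / eps ^+ 2) * L <= n%:R ->
  ~~ [exists x, greedy_fails L x (draw xi w (horizon M) 0)] ->
  (optimal_risk (mdp_kernel M) phi tau s <=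
   optimal_risk (empirical_kernel xi w) phi tau s + eps%:E)%E.
Proof.
move=> C5000 n0 L0 hn /existsPn good.
have Z0 : 0 < Z by rewrite ltr0n.
have n_gt0 : 0 < n%:R :> R by rewrite ltr0n.
have := greedy_exponent C5000 T1 G1 eps_gt0 Z0 ZT n_gt0 hn L0; rewrite -/th -/eta.
move=> {C5000 hn} slack.
have Pd : is_kernel (mdp_kernel M) by move=> v vT x a; exact: kernel_distr.
have Pd' := empirical_kernel_distr xi w n0.
have /andP[r0 rZ] := optimal_risk_itv phid tau_gt0 s Pd.
have /fineK rE := fin_num_itv r0 rZ.
rewrite -leeBlDr//; apply/ereal_infP => _ [pi pid <-].
have e0 := eps_gt0; have T1' := T1; have G1' := G1; have ZT' := ZT.
have th0 : 0 < th by rewrite divr_gt0// mulr_gt0// exprn_gt0.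
have eta0 : 0 < eta by rewrite divr_gt0// mulr_gt0.
apply: (@le_trans _ _ ((fine (optimal_risk (mdp_kernel M) phi tau s) - 3 * eps / 8)
  - eps / 4)%:E).
  by rewrite -[in leLHS]rE -EFinB lee_fin; lra.
apply: (risk_ge_grid (y0 := y0)) => // j k; rewrite -/Z -/F.
set u := fun z => expR (- th * F j k z).
have gd : is_policy (greedy (M := M) u) by apply: greedy_policy => z; exact: expR_gt0.
(* As [eps <= Z <= 2 * T], the product is at most [1 / (16 G)]. *)
have thr : th * (G * Z) <= 2^-1.
  have h : eps <= 2 * T by exact: le_trans eps_le ZT'.
  have h2 : 0 <= G * Z by rewrite mulr_ge0 ?(ltW Z0)//; lra.
  have W0 : 0 < 64 * (G * T) ^+ 2 by rewrite mulr_gt0// exprn_gt0.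
  rewrite /th mulrAC ler_pdivrMr//.
  apply: (@le_trans _ _ ((2 * T) * (G * (2 * T)))).
    by rewrite ler_pM ?(ltW e0)// ler_wpM2l//; lra.
  rewrite (_ : 2 * T * (G * (2 * T)) = 4 * T ^+ 2 * (G * 1)); last by ring.
  rewrite (_ : 2^-1 * _ = 32 * T ^+ 2 * (G * G)); last by field.
  have T20 : 0 <= T ^+ 2 by exact: sqr_ge0.
  apply: ler_pM; [by rewrite mulr_ge0|lra|by rewrite ler_wpM2r//; lra|].
  by rewrite ler_wpM2l//; lra.
have G0 : 0 <= G by lra.
have Fmono z z' : z <= z' -> F j k z <= F j k z'.
  by apply: (grid_integrand_mono (y0 := y0)) => //; exact: ltW.
have Flip z z' : z <= z' -> F j k z' <= F j k z + G * (z' - z).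
  by apply: (grid_integrand_lipschitz (y0 := y0)) => //; exact: ltW.
have good' : good_samples u eta (9 * L) K (horizon M) 0 (draw xi w (horizon M) 0).
  by have := good (j, k); rewrite negbK.
have := greedy_value_le s n0 pid eta0 th0 G0 thr Fmono Flip good'.
rewrite -value_empirical.
have : fine (optimal_risk (mdp_kernel M) phi tau s) <=
    value (mdp_kernel M) (greedy u) (F j k) (horizon M) (t := 0) s.
  rewrite -lee_fin rE; apply: (le_trans (optimal_risk_le _ _ _ _ gd)).
  exact: (risk_le_grid (y0 := y0)).
by rewrite -/T -/Z; lra.
Qed.

End greedy_deviation.
Arguments greedy_fails {R M} phi tau eps y0 {n} L x.

Lemma policy_of_markov_policy (R : realType) (M : mdp R) (pi : markov_policy M) :
  is_markov_policy pi -> is_policy (policy_of_markov pi).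
Proof. by move=> pid t tT h; apply: pid => //; exact/acc_cost_itv/leqW. Qed.

Lemma empirical_kernel_eq (R : realType) (M : mdp R) (n : nat) (Omega : Type)
    (xi : sampling M n Omega) (w w' : Omega) :
  (forall t, (t < horizon M)%N -> forall s a i, xi t s a i w = xi t s a i w') ->
  forall t, (t < horizon M)%N -> forall (s : state M t) (a : action M t) s',
  empirical_kernel xi w s a s' = empirical_kernel xi w' s a s'.
Proof.
move=> e t tT s a s'; rewrite /empirical_kernel; congr (_ / _).
by apply: eq_bigr => i _; rewrite e.
Qed.

Lemma ceil_sample_size (R : realType) (n : nat) (c L : R) :
  0 < c -> 0 < L -> n%:Z = Num.ceil (c * L) -> (0 < n)%N /\ c * L <= n%:R.
Proof.
move=> c0 L0 hn; have h : c * L <= n%:R.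
  by have := ceil_ge (c * L); rewrite -hn -pmulrn.
by split=> //; rewrite -(ltr0n R); apply: lt_le_trans h; exact: mulr_gt0.
Qed.

(** * Assembling the two bounds *)

Section sample_complexity.
Variables (R : realType) (M : mdp R) (phi : R -> \bar R) (tau eps delta C : R).
Hypotheses (phid : is_divergence phi) (tau_gt0 : 0 < tau) (eps_gt0 : 0 < eps).
Hypotheses (delta_itv : 0 < delta < 1) (C5000 : 5000 <= C).
Let T : R := (horizon M)%:R.
Let Z : R := (horizon M).+1%:R.
Let y0 := 16 * T * tau / eps.
Let G := growth_inv phi y0.
Let m := Num.max eps^-1 2.
Let tau2 := Num.max tau 2.
Let nS : R := (num_states M)%:R.
Let nA : R := (num_actions M)%:R.

Let C0 : 0 < C. Proof. by apply: lt_le_trans C5000; rewrite ltr0n. Qed.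
Let T1 : 1 <= T. Proof. by rewrite ler1n horizon_gt0. Qed.
Let G1 : 1 <= G. Proof. exact: growth_inv_ge1. Qed.
Let Z0 : 0 < Z. Proof. by rewrite ltr0n. Qed.
Let ZT : Z <= 2 * T. Proof. by rewrite /Z -natr1 -/T; have := T1; lra. Qed.
Let Zy0 : Z <= eps / (8 * tau) * y0.
Proof.
(* The 16 in [y0] is chosen here: there are [T + 1] stages, so the total cost is at most
   [Z = T + 1 <= 2 * T]. *)
have -> : eps / (8 * tau) * y0 = 2 * T; last exact: ZT.
by rewrite /y0; field; rewrite !gt_eqF.
Qed.
Let m2 : 2 <= m. Proof. by rewrite le_max lexx orbT. Qed.
Let em : eps^-1 <= m. Proof. by rewrite le_max lexx. Qed.
Let tau2_ge : 2 <= tau2. Proof. by rewrite le_max lexx orbT. Qed.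
Let nA1 : 1 <= nA.
Proof.
rewrite ler1n; apply: leq_trans (action_gt0 (leq0n (horizon M))) _.
exact: (leq_bigmax (F := fun t : 'I_(horizon M).+1 => #|action M t|) ord0).
Qed.
Let nS1 (s : state M 0) : 1 <= nS.
Proof.
rewrite ler1n.
apply: leq_trans (leq_bigmax (F := fun t : 'I_(horizon M).+1 => #|state M t|) ord0).
by apply/card_gt0P; exists s.
Qed.
Let delta0 : 0 < delta. Proof. by case/andP: delta_itv. Qed.
Let delta1 : delta < 1. Proof. by case/andP: delta_itv. Qed.
Let Pd : is_kernel (mdp_kernel M).
Proof. by move=> v vT x a; exact: kernel_distr. Qed.

Let J_le : (grid_size eps Z)%:R <= 17 * (T * m).
Proof. exact: grid_size_le T1 eps_gt0 (ltW Z0) ZT em m2. Qed.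

Let sure (d : measure_display) (Omega : measurableType d)
    (Pr : probability Omega R) (A : set Omega) :
  (forall w, A w) -> ((1 - delta)%:E <= Pr A)%E.
Proof.
move=> Aw; rewrite (_ : A = setT); last by apply/seteqP; split.
by rewrite probability_setT lee_fin; have := delta0; lra.
Qed.

Lemma policy_deviation (pi : policy M) (Q : R) (n : nat)
    (d : measure_display) (Omega : measurableType d) (Pr : probability Omega R)
    (xi : sampling M n Omega) :
  is_policy pi -> iid_samples Pr xi ->
  nS * T * tau2 * G * m <= Q * delta ->
  n%:Z = Num.ceil (C * (T ^+ 2 * G ^+ 2 / eps ^+ 2) * ln Q) ->
  ((1 - delta)%:E <= Pr [set w | forall s : state M 0,
     `|risk (empirical_kernel xi w) phi tau pi s -
       risk (mdp_kernel M) phi tau pi s| <= eps%:E])%E.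
Proof.
move=> pid xid QE hn.
(* Without an initial state the event is certain; a state gives [1 <= nS]. *)
have [[s0 _]|no_state] := pselect (exists s : state M 0, True); last first.
  by apply: sure => w s; case: no_state; exists s.
have QE' : T * nS * 1 * tau2 * G * m <= Q * delta.
  by rewrite mulr1 (mulrC T).
have [Q4 _ _ _] := log_arg_bounds T1 (nS1 s0) (lexx 1) G1 tau2_ge m2 delta0 delta1 QE'.
have Q0 : 0 < Q by lra.
have L0 : 0 < ln Q by rewrite ln_gt0//; lra.
have c0 : 0 < C * (T ^+ 2 * G ^+ 2 / eps ^+ 2).
  by rewrite mulr_gt0// divr_gt0 ?mulr_gt0 ?exprn_gt0// (lt_le_trans ltr01)// ?T1 ?G1.
have [n0 nle] := ceil_sample_size c0 L0 hn.
have Pd' w := empirical_kernel_distr xi w n0.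
(* Both risks lie in [[0, Z]], so the case [Z <= eps] is immediate; otherwise [eps < Z] keeps the
   Chernoff parameter admissible. *)
have [Zeps|epsZ] := leP Z eps.
  by apply: sure => w s; apply: abse_sub_le_itv Zeps; exact: risk_itv.
apply: (@probability_ge_of_samples _ M n _ _ Pr xi _
  (fun sg => [exists x, deviates phi tau eps (fun=> pi) x sg]) delta xid).
- move=> w w' e Aw s; rewrite (risk_eq phi tau pi s (P' := empirical_kernel xi w))//.
  by apply: empirical_kernel_eq => t tT *; rewrite e.
- move=> w good s.
  have [h1 h2] := risk_close phid tau_gt0 eps_gt0 Zy0 s n0 (fun=> pid) good.
  have /andP[a0 aZ] := risk_itv phid tau_gt0 s (Pd' w) pid.
  have /andP[b0 bZ] := risk_itv phid tau_gt0 s Pd pid.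
  have e3 : ((eps / 2 + eps / 4)%:E <= eps%:E)%E.
    by rewrite lee_fin; have := eps_gt0; lra.
  apply: abse_sub_le; [exact: fin_num_itv aZ|exact: fin_num_itv bZ| |].
    by apply: (le_trans h1); exact: leeD2l.
  by apply: (le_trans h2); exact: leeD2l.
have hQ := tail_exponent C5000 T1 G1 eps_gt0 Z0 ZT (ltW L0) nle.
apply: le_trans (deviation_mass phid tau_gt0 eps_gt0 Zy0 (ltW epsZ) n0 (fun=> pid) Q0 hQ) _.
apply: le_trans (union_bound_tail T1 (nS1 s0) (lexx 1) G1 tau2_ge m2
  delta0 delta1 QE' (ler0n _ _) J_le) _.
by have := delta0; lra.
Qed.

Lemma optimal_deviation (Q : R) (n : nat)
    (d : measure_display) (Omega : measurableType d) (Pr : probability Omega R)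
    (xi : sampling M n Omega) :
  iid_samples Pr xi ->
  T * nS * nA * tau2 * G * m <= Q * delta ->
  n%:Z = Num.ceil (C * (T ^+ 3 * G ^+ 2 / eps ^+ 2) * ln Q) ->
  ((1 - delta)%:E <= Pr [set w | forall s : state M 0,
     `|optimal_risk (empirical_kernel xi w) phi tau s -
       optimal_risk (mdp_kernel M) phi tau s| <= eps%:E])%E.
Proof.
move=> xid QE hn.
have [[s0 _]|no_state] := pselect (exists s : state M 0, True); last first.
  by apply: sure => w s; case: no_state; exists s.
have [Q4 _ _ _] := log_arg_bounds T1 (nS1 s0) nA1 G1 tau2_ge m2 delta0 delta1 QE.
have Q0 : 0 < Q by lra.
have L0 : 0 < ln Q by rewrite ln_gt0//; lra.
have T0 : 0 < T by rewrite (lt_le_trans ltr01).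
have G0 : 0 < G by rewrite (lt_le_trans ltr01).
have c0 : 0 < C * (T ^+ 3 * G ^+ 2 / eps ^+ 2).
  by rewrite mulr_gt0// divr_gt0 ?mulr_gt0 ?exprn_gt0.
have [n0 nle] := ceil_sample_size c0 L0 hn.
(* As [T >= 1], the sample size with [T ^+ 3] also meets the requirement for fixed policies. *)
have nle2 : C * (T ^+ 2 * G ^+ 2 / eps ^+ 2) * ln Q <= n%:R.
  apply: le_trans nle; rewrite ler_wpM2r ?(ltW L0)// ler_wpM2l ?(ltW C0)//.
  rewrite ler_wpM2r ?invr_ge0 ?exprn_ge0 ?(ltW eps_gt0)//.
  by rewrite ler_wpM2r ?exprn_ge0 ?(ltW G0)// ler_weXn2l.
have Pd' w := empirical_kernel_distr xi w n0.
have [Zeps|epsZ] := leP Z eps.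
  by apply: sure => w s; apply: abse_sub_le_itv Zeps; exact: optimal_risk_itv.
have e8 : 0 < eps / 8 by rewrite divr_gt0.
have [pis hpis] := near_optimal_policy phid tau_gt0 Pd e8.
have pid s := (hpis s).1.
apply: (@probability_ge_of_samples _ M n _ _ Pr xi _
  (fun sg => [exists x, deviates phi tau eps pis x sg] ||
     [exists x, greedy_fails phi tau eps y0 (ln Q) x sg]) delta xid).
- move=> w w' e Aw s; rewrite (optimal_risk_eq phi tau s (P' := empirical_kernel xi w))//.
  by apply: empirical_kernel_eq => t tT *; rewrite e.
- move=> w; rewrite negb_or => /andP[good_pis good_greedy] s.
  have /andP[a0 aZ] := optimal_risk_itv phid tau_gt0 s (Pd' w).
  have /andP[b0 bZ] := optimal_risk_itv phid tau_gt0 s Pd.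
  apply: abse_sub_le; [exact: fin_num_itv aZ|exact: fin_num_itv bZ| |].
    (* The near-optimal policy for the true kernel is tried on the empirical one: [3 * eps / 4] for
       concentration plus [eps / 8] for near-optimality. *)
    apply: le_trans (optimal_risk_le _ _ _ _ (pid s)) _.
    have [h1 _] := risk_close phid tau_gt0 eps_gt0 Zy0 s n0 pid good_pis.
    apply: (le_trans h1).
    apply: le_trans (leeD2r _ (hpis s).2) _.
    rewrite -addeA leeD2l// -EFinD lee_fin; have := eps_gt0; lra.
  exact: (optimal_risk_lower phid tau_gt0 eps_gt0 Zy0 (ltW epsZ) s C5000 n0 (ltW L0) nle).
have hQ := tail_exponent C5000 T1 G1 eps_gt0 Z0 ZT (ltW L0) nle2.
have dev := deviation_mass phid tau_gt0 eps_gt0 Zy0 (ltW epsZ) n0 pid Q0 hQ.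
have dev' := le_trans dev (union_bound_tail T1 (nS1 s0) nA1 G1 tau2_ge m2
  delta0 delta1 QE (ler0n _ _) J_le).
have gre := @greedy_fails_mass _ M phi tau eps y0 n Q Q0.
have K_le := greedy_size_le M y0 phid eps_gt0 em m2.
have gre' := le_trans gre (union_bound_dp T1 (nS1 s0) nA1 G1 tau2_ge m2
  delta0 delta1 QE (ler0n _ _) J_le (ler0n _ _) K_le).
rewrite [leRHS](_ : delta = delta / 2 + delta / 2); last by field.
apply: le_trans (lerD dev' gre').
by apply: mass_or => sg; exact: sample_weight_ge0.
Qed.

End sample_complexity.

Theorem theorem4p1 (R : realType) :
  exists C : R, 0 < C /\
  forall (M : mdp R) (phi : R -> \bar R) (tau eps delta : R),
    is_divergence phi -> 0 < tau -> 0 < eps -> 0 < delta < 1 ->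
    let T : R := (horizon M)%:R in
    let g : R := growth_inv phi (16 * T * tau / eps) in
    (forall (pi : markov_policy M) (L : R),
       is_markov_policy pi -> 0 < L -> lipschitz_policy L pi ->
       forall n : nat,
         n%:Z = Num.ceil (C * (T ^+ 2 * g ^+ 2 / eps ^+ 2) *
           ln (T * (num_states M)%:R * Num.max L 2 * Num.max tau 2 * g *
               Num.max (eps^-1) 2 / delta)) ->
       forall (d : measure_display) (Omega : measurableType d)
         (Pr : probability Omega R) (xi : sampling M n Omega),
         iid_samples Pr xi ->
         ((1 - delta)%:E <=
          Pr [set w | forall s : state M 0,
                `|risk (empirical_kernel xi w) phi tau (policy_of_markov pi) s
                  - risk (mdp_kernel M) phi tau (policy_of_markov pi) s|
                <= eps%:E])%E)
    /\
    (forall n : nat,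
       n%:Z = Num.ceil (C * (T ^+ 3 * g ^+ 2 / eps ^+ 2) *
         ln (T * (num_states M)%:R * (num_actions M)%:R * Num.max tau 2 * g *
             Num.max (eps^-1) 2 / delta)) ->
       forall (d : measure_display) (Omega : measurableType d)
         (Pr : probability Omega R) (xi : sampling M n Omega),
         iid_samples Pr xi ->
         ((1 - delta)%:E <=
          Pr [set w | forall s : state M 0,
                `|optimal_risk (empirical_kernel xi w) phi tau s
                  - optimal_risk (mdp_kernel M) phi tau s|
                <= eps%:E])%E).
Proof.
(* The value 5000 exceeds both constants required above, 1152 for a fixed policy and 4608 for the
   greedy comparison. *)
have [C C5000] : exists C : R, 5000 <= C by exists 5000.
exists C; split; first by apply: lt_le_trans C5000; rewrite ltr0n.
move=> M phi tau eps delta phid tau0 eps0 /[dup] delta_itv /andP[delta0 _] T g.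
split=> [pi L pid _ _|] n hn d Omega Pr xi xid; last first.
  apply: (optimal_deviation phid tau0 eps0 delta_itv C5000 xid _ hn).
  by rewrite divfK// gt_eqF.
apply: (policy_deviation phid tau0 eps0 delta_itv C5000 _ xid _ hn).
  exact: policy_of_markov_policy.
rewrite divfK ?gt_eqF// (mulrC (num_states M)%:R).
have g0 : 0 <= g by rewrite (le_trans ler01)//; exact: growth_inv_ge1.
rewrite !ler_wpM2r//; [by rewrite le_max (ler0n _ 2) orbT|by rewrite le_max (ler0n _ 2) orbT|].
(* The factor [Num.max L 2] is at least 1, so it only enlarges the argument of the logarithm. *)
by rewrite ler_peMr ?mulr_ge0// le_max ler1n orbT.
Qed.
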